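(* Let $k\ge 2$ be an integer. (1) For all integers $n\ge 0$ and $0\le r<2^n$, \[ I(2^n+r,k)=2^{n+k-1}+r . \] (2) One has \[ E(1,k)\le 2^{k-2}+1, \] and for all integers $n\ge 0$ and $1\le r\le 2^n$, \[ E(2^n+r,k)=2^{n+k-1}+r . \]
   Context: A $k$-bit Gray code is a $k\times 2^k$ binary matrix $G=(g_1,\dots,g_{2^k})$ whose columns are all the vectors of $\{0,1\}^k$ such that any two consecutive columns differ in exactly one entry. Its transition counts are $c(G)=(c_1(G),\dots,c_k(G))$, where $c_i(G)$ is the number of $m\in\{1,\dots,2^k-1\}$ such that $g_m,g_{m+1}$ differ in row $i$. Let $\mathfrak c_1+\dots+\mathfrak c_k=j(2^k-1)$. A binary matrix $\mathcal G$ of size $k\times j2^k$ is a $(\mathfrak c_1,\dots,\mathfrak c_k)$-equiparting matrix if (i) $\mathcal G=(G_1,\dots,G_j)$ for $k$-bit Gray codes $G_1,\dots,G_j$ such that the last column of $G_i$ equals the first column of $G_{i+1}$ for $1\le i<j$, and (ii) $c(G_1)+\dots+c(G_j)=(\mathfrak c_1,\dots,\mathfrak c_k)$. The group $(\mathbb Z/2)^k\rtimes\mathfrak S_k$ acts on binary matrices with $k$ rows: $\mathfrak S_k$ permutes rows and the $i$-th factor of $(\mathbb Z/2)^k$ inverts all bits of row $i$. Let $(\mathfrak S_k)_{(\mathfrak c_1,\dots,\mathfrak c_k)}\subseteq\mathfrak S_k$ be the stabilizer of $(\mathfrak c_1,\dots,\mathfrak c_k)$ under permutation of coordinates. Two $(\mathfrak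 c_1,\dots,\mathfrak c_k)$-equiparting matrices are isomorphic if they lie in one $(\mathbb Z/2)^k$-orbit, and equivalent if they lie in one orbit of $(\mathbb Z/2)^k\rtimes(\mathfrak S_k)_{(\mathfrak c_1,\dots,\mathfrak c_k)}$. For integers $j\ge 1$, $k\ge 2$, let $\mathcal I(j,k)$ (resp. $\mathcal E(j,k)$) be the set of all integer tuples $(\mathfrak c_1,\dots,\mathfrak c_k)$ with $\mathfrak c_1+\dots+\mathfrak c_k=j(2^k-1)$ such that the number of non-isomorphic (resp. non-equivalent) $(\mathfrak c_1,\dots,\mathfrak c_k)$-equiparting matrices, i.e. the number of isomorphism classes (resp. equivalence classes), is odd. Then $I(j,k)$ (resp. $E(j,k)$) is the minimum of $\max(\mathfrak c_1,\dots,\mathfrak c_k)$ over all $(\mathfrak c_1,\dots,\mathfrak c_k)$ in $\mathcal I(j,k)$ (resp. $\mathcal E(j,k)$). *)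

(* Defs.v *)
From mathcomp Require Import all_boot all_order all_fingroup all_algebra.

Set Implicit Arguments.
Unset Strict Implicit.
Unset Printing Implicit Defensive.

Import Order.TTheory GRing.Theory Num.Theory.

Lemma exp2_gt0 (k : nat) : 0 < 2 ^ k.
Proof. by rewrite expn_gt0. Qed.

Definition first_idx (k : nat) : 'I_(2 ^ k) := Ordinal (exp2_gt0 k).
Definition last_idx (k : nat) : 'I_(2 ^ k) := rev_ord (first_idx k).

(* Since the matrix has exactly 2 ^ k columns, surjectivity of [col ^~ G]
   already forces every vector to occur exactly once. *)
Definition gray_code (k : nat) (G : 'M[bool]_(k, 2 ^ k)) : bool :=
  [forall v : 'cV[bool]_k, exists m : 'I_(2 ^ k), col m G == v] &&
  [forall m : 'I_(2 ^ k), forall m' : 'I_(2 ^ k),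
     (m' == m.+1 :> nat) ==> (#|[set i : 'I_k | G i m != G i m']| == 1)].

Definition transition_count (k : nat) (G : 'M[bool]_(k, 2 ^ k)) (i : 'I_k) : nat :=
  #|[set m : 'I_(2 ^ k) |
       [exists m' : 'I_(2 ^ k), (m' == m.+1 :> nat) && (G i m != G i m')]]|.

Lemma block_idx_subproof (j N : nat) (a : 'I_j) (m : 'I_N) : a * N + m < j * N.
Proof.
apply: (@leq_trans (a.+1 * N)); last by rewrite leq_mul2r ltn_ord orbT.
by rewrite mulSn addnC ltn_add2r ltn_ord.
Qed.

(* [A] is the concatenation of its blocks [block A 0, ..., block A (j - 1)]. *)
Definition block (j k : nat) (A : 'M[bool]_(k, j * 2 ^ k)) (a : 'I_j) :
    'M[bool]_(k, 2 ^ k) :=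
  \matrix_(i < k, m < 2 ^ k) A i (Ordinal (block_idx_subproof a m)).

Definition equiparting (j k : nat) (c : {ffun 'I_k -> int})
    (A : 'M[bool]_(k, j * 2 ^ k)) : bool :=
  [&& [forall a : 'I_j, gray_code (block A a)],
      [forall a : 'I_j, forall b : 'I_j, (b == a.+1 :> nat) ==>
         (col (last_idx k) (block A a) == col (first_idx k) (block A b))]
    & [forall i : 'I_k,
         Posz (\sum_(a < j) transition_count (block A a) i) == c i]].

Definition flip_rows (k N : nat) (e : {ffun 'I_k -> bool}) (A : 'M[bool]_(k, N)) :
    'M[bool]_(k, N) :=
  \matrix_(i < k, m < N) (e i (+) A i m).

Definition stabilizes (k : nat) (c : {ffun 'I_k -> int}) (s : 'S_k) : bool :=
  [forall i : 'I_k, c (s i) == c i].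

Definition isomorphic (k N : nat) : rel 'M[bool]_(k, N) :=
  fun A B => [exists e : {ffun 'I_k -> bool}, B == flip_rows e A].

(* Every element of the semidirect product is uniquely the composite of a row
   permutation followed by row inversions. *)
Definition equivalent (k N : nat) (c : {ffun 'I_k -> int}) : rel 'M[bool]_(k, N) :=
  fun A B => [exists e : {ffun 'I_k -> bool}, exists s : 'S_k,
                stabilizes c s && (B == flip_rows e (row_perm s A))].

Definition equiparting_set (j k : nat) (c : {ffun 'I_k -> int}) :
    {set 'M[bool]_(k, j * 2 ^ k)} :=
  [set A | equiparting c A].

Definition num_noniso (j k : nat) (c : {ffun 'I_k -> int}) : nat :=
  #|equivalence_partition (@isomorphic k (j * 2 ^ k)) (equiparting_set j c)|.

Definition num_nonequiv (j k : nat) (c : {ffun 'I_k -> int}) : nat :=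
  #|equivalence_partition (@equivalent k (j * 2 ^ k) c) (equiparting_set j c)|.

Definition calI (j k : nat) (c : {ffun 'I_k -> int}) : Prop :=
  (\sum_(i < k) c i)%R = Posz (j * (2 ^ k - 1)) /\ odd (num_noniso j c).

Definition calE (j k : nat) (c : {ffun 'I_k -> int}) : Prop :=
  (\sum_(i < k) c i)%R = Posz (j * (2 ^ k - 1)) /\ odd (num_nonequiv j c).

Definition is_max (k : nat) (c : {ffun 'I_k -> int}) (v : int) : Prop :=
  (exists i : 'I_k, c i = v) /\ (forall i : 'I_k, (c i <= v)%R).

(* Minima are stated relationally: a value [v] with [is_min_max S v] is unique,
   and its existence includes that [S] is nonempty. *)
Definition is_min_max (k : nat) (S : {ffun 'I_k -> int} -> Prop) (v : int) : Prop :=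
  (exists c : {ffun 'I_k -> int}, S c /\ is_max c v) /\
  (forall (c : {ffun 'I_k -> int}) (w : int), S c -> is_max c w -> (v <= w)%R).

(* [is_I j k v] and [is_E j k v] stand for I(j,k) = v and E(j,k) = v. *)
Definition is_I (j k : nat) (v : int) : Prop := is_min_max (@calI j k) v.
Definition is_E (j k : nat) (v : int) : Prop := is_min_max (@calE j k) v.

(* Main.v *)
Require Import Defs.
From mathcomp Require Import all_boot all_order all_fingroup all_algebra.
From mathcomp Require Import mpoly.
From mathcomp Require Import zify ring.

Set Implicit Arguments.
Unset Strict Implicit.
Unset Printing Implicit Defensive.

Import Order.TTheory GRing.Theory Num.Theory.

(** Up to inversion of rows, a Gray code is its word of transitions: a word of
length 2^k - 1 over the k rows in which every nonempty infix contains some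
letter an odd number of times ([gray]). Blocks can be glued freely, so the
isomorphism classes of c-equiparting matrices are the families of j gray words
of total content c (the content of a word counts its letters). Their number is
the coefficient of x^c in P^j, where P is the sum of x^(content w) over the
gray words w of length 2^k - 1 ([gray_poly], [word_families_poly]). The
stabilizer of c acts freely on gray words, because such a word uses every
letter; hence equivalence classes are counted by the coefficient of x^c in C
P^(j-1), where C sums over one word in each orbit of the stabilizer
([canonical_set_poly]), and the number of isomorphism classes is the number of
equivalence classes times the order of the stabilizer.

Reversal is an involution on the gray words of a given content. Its nonempty
fixed points are the words u m (rev u) with u gray and free of m, since any
other palindrome has a nonempty infix with all letter counts even. By
induction, the number of gray words of content c is odd exactly when the
nonzero values of c are 1, 2, 4, ..., each taken once ([odd_num_grayP]); call
such contents odd. So, modulo 2, P is the Dickson polynomial: the sum of x_s(0)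
x_s(1)^2 x_s(2)^4 ... over all permutations s ([gray_poly_F2]).

Lower bounds. Modulo 2, each monomial of P^(2^n) contains some x_i^(2^(n+k-1)),
and each monomial of P^r, and of C P^(r-1) if r >= 1, is divisible by the r-th
power of every variable. Hence a monomial with odd coefficient in P^(2^n + r),
or in C P^(2^n + r - 1), has an exponent at least 2^(n+k-1) + r.

Upper bounds for r < 2^n. Writing D_k for the Dickson polynomial in k
variables, the coefficient of x_k^(2^(n+k-1) + r) in D_k^(2^n + r) is
D_(k-1)^(2^n + 2r), up to monomials in which another exponent is at least
2^(n+k-1) + r. Induction on k gives the required monomial ([dickson_witness]).
The number of isomorphism classes being odd, so is the number of equivalence
classes, which divides it.

Upper bound for r = 2^n. Number the letters from 0, and let mu take the value
2^(k-1) + 1 at the first and last letters and 2^(i+1) at every other letter i.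
Modulo 4, P^(2^(n+1)) is the square of the sum of x^(2^n d) over the odd
contents d of degree 2^k - 1, and mu is a sum of two odd contents in exactly
two ways, which differ by the order of the summands ([geom_pair_unique]). So
there are 2 modulo 4 isomorphism classes for 2^n mu; its stabilizer has order
2, and the number of equivalence classes is odd.

One block, k >= 3. A gray word in which the last letter occurs once splits
there into two gray words over the other k - 1 letters, so the content that is
1 at the last letter and the above mu, for k - 1 letters, elsewhere also has 2
modulo 4 classes and a stabilizer of order 2. For k = 2 the content with values
1 and 2 serves. *)

(** * Gray words *)

Lemma odd_size_involution (T : eqType) (f : T -> T) (l : seq T) :
    uniq l -> {in l, forall x, f x \in l} -> {in l, forall x, f (f x) = x} ->
  odd (size l) = odd (count (fun x => f x == x) l).
Proof.
have [n] := ubnP (size l); elim: n l => // n IHn [|x l] //= /ltnSE le_l.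
case/andP=> xl Ul fl ff.
have ffx : f (f x) = x by apply: ff; rewrite mem_head.
have [fx | fx] := eqVneq (f x) x; last first.
  have fxl : f x \in l by have := fl x (mem_head _ _); rewrite inE (negPf fx).
  have sub y : y \in rem (f x) l -> y \in x :: l.
    by move=> /mem_rem yl; rewrite inE yl orbT.
  have := perm_to_rem fxl; move/seq.permP=> /(_ (fun x => f x == x)) /= ->.
  rewrite ffx eq_sym (negPf fx) add0n add0n.
  rewrite (perm_size (perm_to_rem fxl)) /= negbK; apply: IHn.
  - by rewrite size_rem //; case: (l) fxl le_l => //= *; lia.
  - exact: rem_uniq.
  - move=> y yr; rewrite mem_rem_uniq // inE /=.
    have yl := mem_rem yr.
    have := fl y (sub _ yr); rewrite inE => /orP [/eqP fy | fyl].
      by have := yr; rewrite mem_rem_uniq // -fy (ff y (sub _ yr)) !inE eqxx.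
    rewrite fyl andbT; apply: contraNneq xl => fyx.
    by rewrite -ffx -fyx ff // sub.
  - by move=> y /sub; apply: ff.
rewrite oddD /=; congr (~~ _); apply: IHn => //.
  move=> y yl; have := fl y; rewrite !inE yl orbT => /(_ isT) /orP [/eqP fy|//].
  by move: xl; rewrite -fx -fy ff ?yl // inE yl orbT.
by move=> y yl; rewrite ff // inE yl orbT.
Qed.

Section Words.
Variable T : finType.
Implicit Types (x m : T) (a b d u v w : seq T).

(** Every letter occurs an even number of times. *)
Definition evenw w := [forall x, ~~ odd (count_mem x w)].

(** Gray words, of any length: every nonempty infix has a letter with an odd
number of occurrences. Equivalently, the vertices that the word visits in the
hypercube are pairwise distinct. *)
Definition gray w :=
  [forall i : 'I_(size w).+1, forall j : 'I_(size w).+1,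
     (i < j) ==> ~~ evenw (take (j - i) (drop i w))].

Lemma evenwP w : reflect (forall x, odd (count_mem x w) = false) (evenw w).
Proof. by apply: (iffP forallP) => h x; [exact/negbTE/h | rewrite h]. Qed.

Lemma grayP w :
  reflect (forall a b d, w = a ++ b ++ d -> evenw b -> b = [::]) (gray w).
Proof.
apply: (iffP forallP) => [h a b d Dw | h i].
  apply: contraTeq => b0.
  have sb : 0 < size b by case: (b) b0.
  have li : size a < (size w).+1 by rewrite Dw !size_cat; lia.
  have lj : size a + size b < (size w).+1 by rewrite Dw !size_cat; lia.
  move/forallP: (h (Ordinal li)) => /(_ (Ordinal lj)) /=.
  by rewrite -{1}[size a]addn0 ltn_add2l sb /= addKn Dw drop_size_cat // take_size_cat.
apply/forallP=> j; apply/implyP=> ij; apply/negP=> /(h (take i w) _ (drop (j - i) (drop i w))).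
rewrite !cat_take_drop => /(_ erefl) /(congr1 size).
by rewrite size_take size_drop /=; have := ltn_ord j; case: ifP => /=; lia.
Qed.

Lemma gray_infix a b d : gray (a ++ b ++ d) -> gray b.
Proof.
move/grayP=> h; apply/grayP=> a' b' d' Db.
by apply: (h (a ++ a') b' (d' ++ d)); rewrite Db !catA.
Qed.

Lemma evenw_rev w : evenw (rev w) = evenw w.
Proof. by apply: eq_forallb => x; rewrite count_rev. Qed.

Lemma gray_rev w : gray (rev w) = gray w.
Proof.
suff h v : gray v -> gray (rev v) by apply/idP/idP => /h; rewrite ?revK.
move/grayP=> h; apply/grayP=> a b d Dv.
rewrite -evenw_rev => /(h (rev d) _ (rev a)).
rewrite -[v]revK Dv !rev_cat catA => /(_ erefl) /(congr1 rev).
by rewrite revK.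
Qed.

Lemma gray_nil : gray [::].
Proof. by apply/grayP=> -[|? ?] [|? ?]. Qed.

Lemma gray_cat_cons u m v :
  m \notin u -> m \notin v -> gray u -> gray v -> gray (u ++ m :: v).
Proof.
move=> mu mv /grayP gu /grayP gv; apply/grayP=> a b d Dw eb.
have [mb|mb] := boolP (m \in b).
  have := congr1 (count_mem m) Dw; rewrite !count_cat /= eqxx.
  rewrite (count_memPn mu) (count_memPn mv) /=.
  have := evenwP _ eb m; move: mb; rewrite -has_pred1 has_count.
  move: (count _ b) (count _ a) (count _ d) => [|[|nb]] na nd //= _ _.
  by move=> ?; exfalso; lia.
have: size (a ++ b) <= size u \/ (size u).+1 <= size a.
  have [|lt1] := leqP (size (a ++ b)) (size u); first by left.
  have [|lt2] := leqP (size u).+1 (size a); first by right.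
  case/negP: mb; have: nth m (a ++ b ++ d) (size u) = m.
    by rewrite -Dw nth_cat ltnn subnn.
  rewrite nth_cat ltnNge -ltnS lt2 /= nth_cat.
  move: lt1; rewrite size_cat => lt1.
  have lt3 : size u - size a < size b by lia.
  by rewrite lt3 => <-; apply: mem_nth.
case=> [le|le].
  have Du : u = a ++ b ++ take (size u - size (a ++ b)) d.
    have := congr1 (take (size u)) Dw; rewrite take_size_cat // => {1}->.
    by rewrite catA take_cat ltnNge le /= -catA.
  exact: gu Du eb.
have Dv : v = drop (size u).+1 a ++ b ++ d.
  have := congr1 (drop (size u).+1) Dw.
  rewrite -cat_rcons drop_size_cat ?size_rcons // => ->.
  rewrite drop_cat; move: le; rewrite leq_eqVlt => /orP[/eqP e|-> //].
  by rewrite e ltnn subnn drop0 drop_size.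
exact: gv Dv eb.
Qed.

(** The palindromes among gray words; those of even length are excluded
because they are even themselves. *)
Lemma gray_rev_fixed w :
    gray w -> rev w = w -> w != [::] ->
  exists u m, [/\ w = u ++ m :: rev u, m \notin u & gray u].
Proof.
move=> gw rw w0.
pose n := (size w)./2; pose u := take n w; pose v := drop n w.
have Dw : w = u ++ v by rewrite cat_take_drop.
have su : size u = n by rewrite size_takel //; rewrite /n; lia.
have [ow | ew] := boolP (odd (size w)); last first.
  have sv : size v = n by rewrite size_drop /n; lia.
  have rv : v = rev u.
    move: rw; rewrite {1}Dw rev_cat Dw => /eqP; rewrite eqseq_cat ?size_rev ?su //.
    by case/andP=> _ /eqP.
  case/eqP: w0; apply: (grayP _ gw [::] w [::]); first by rewrite cats0.
  by apply/evenwP=> x; rewrite Dw rv count_cat count_rev addnn odd_double.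
have sv : size v = n.+1 by rewrite size_drop /n; lia.
case Dv: v sv => [//|m v'] /= [sv'].
have rv : v' = rev u.
  move: rw; rewrite {1}Dw Dv rev_cat Dw Dv rev_cons -cats1 -catA => /eqP.
  rewrite eqseq_cat ?size_rev ?su // => /andP[/eqP <- _].
  by rewrite revK.
have Dw' : w = u ++ m :: rev u by rewrite Dw Dv rv.
exists u, m; split=> //; last by apply: (@gray_infix [::] u (m :: rev u)); rewrite -Dw'.
apply/negP=> /splitPr Du; case: Du Dw' => a d Dw'.
(* If m occurred in u = a ++ m :: d, the infix m d m (rev d) of w would be even. *)
have: m :: d ++ m :: rev d = [::]; last by [].
apply: (grayP _ gw a _ (m :: rev a)).
  by rewrite Dw' rev_cat rev_cons cat_rcons -!catA /= -!catA.
apply/evenwP=> x; rewrite /= count_cat /= count_rev.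
by rewrite [X in _ + X]addnCA addnn addnA addnn oddD !odd_double.
Qed.

End Words.

Lemma gray_map (T T' : finType) (f : T -> T') (w : seq T) :
  injective f -> gray w -> gray (map f w).
Proof.
move=> fI /grayP gw; apply/grayP=> a b d Dw eb.
pose b' := take (size b) (drop (size a) w).
have Db : b = map f b'.
  by rewrite map_take map_drop Dw drop_size_cat // take_size_cat.
suff Eb : b' = [::] by rewrite Db Eb.
apply: (gw (take (size a) w) _ (drop (size b) (drop (size a) w))).
  by rewrite !cat_take_drop.
apply/evenwP=> x; move/evenwP/(_ (f x)): eb; rewrite Db count_map => <-.
by congr (odd _); apply: eq_count => y /=; rewrite (inj_eq fI).
Qed.

(** * Counting gray words by content, modulo 2 *)

Section Content.
Variable k : nat.
Implicit Types (c d : 'X_{1..k}) (m : 'I_k) (u v w s : seq 'I_k).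

(** The content of a word as an exponent vector: the number of occurrences of
each letter. *)
Definition content w : 'X_{1..k} := [multinom count_mem i w | i < k].

Lemma contentE w i : content w i = count_mem i w.
Proof. by rewrite mnmE. Qed.

Lemma content_nil : content [::] = 0%MM.
Proof. by apply/mnmP=> i; rewrite !mnmE. Qed.

Lemma content_cons m w : content (m :: w) = (U_(m) + content w)%MM.
Proof. by apply/mnmP=> i; rewrite mnmDE !contentE mnm1E. Qed.

Lemma content_cat u v : content (u ++ v) = (content u + content v)%MM.
Proof. by apply/mnmP=> i; rewrite mnmDE !contentE count_cat. Qed.

Lemma content_rev w : content (rev w) = content w.
Proof. by apply/mnmP=> i; rewrite !contentE count_rev. Qed.

Lemma content_flatten (l : seq (seq 'I_k)) :
  content (flatten l) = (\sum_(w <- l) content w)%MM.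
Proof.
by elim: l => [|w l IHl]; rewrite ?big_nil ?content_nil // big_cons /= content_cat IHl.
Qed.

Lemma mdeg_content w : mdeg (content w) = size w.
Proof.
elim: w => [|m w IHw]; first by rewrite content_nil mdeg0.
by rewrite content_cons mdegD mdeg1 IHw.
Qed.

Lemma eq_content_perm u v : (content u == content v) = perm_eq u v.
Proof.
apply/eqP/idP => [e|/seq.permP e]; last by apply/mnmP=> i; rewrite !contentE e.
by apply/allP=> i _ /=; rewrite -!contentE e.
Qed.

Lemma content_exists c : exists w, content w == c.
Proof.
exists (flatten [seq nseq (c i) i | i <- enum 'I_k]); apply/eqP.
rewrite content_flatten big_map big_enum /=; apply/mnmP=> j.
rewrite mnm_sumE (bigD1 j) //= big1 => [|i /negPf ij].
  by rewrite contentE count_nseq /= eqxx mul1n addn0.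
by rewrite contentE count_nseq /= ij.
Qed.

(** The duplicate-free list of the gray words of content [c]. *)
Definition gray_words c := [seq w <- permutations (xchoose (content_exists c)) | gray w].

Definition num_gray c := size (gray_words c).

Lemma mem_gray_words c w : (w \in gray_words c) = gray w && (content w == c).
Proof.
rewrite mem_filter mem_permutations -eq_content_perm.
by congr (_ && (_ == _)); apply/eqP/(xchooseP (content_exists c)).
Qed.

Lemma gray_words_uniq c : uniq (gray_words c).
Proof. by rewrite filter_uniq // permutations_uniq. Qed.

Lemma mnm_U1D2E m d i : (U_(m) + d *+ 2)%MM i = (m == i) + (d i).*2.
Proof. by rewrite !mnmDE mnm1E addnn. Qed.

(** Reversal preserves gray words and their content. *)
Lemma odd_num_gray_palindrome c : odd (num_gray c) = odd (count (fun w => rev w == w) (gray_words c)).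
Proof.
apply: odd_size_involution (gray_words_uniq c) _ _ => w; last by rewrite revK.
by rewrite !mem_gray_words gray_rev content_rev.
Qed.

(** The palindromes of content [c] are the words [u ++ m :: rev u], with [u] a gray
word of content [d]. *)
Lemma odd_num_gray_double c m d : c = (U_(m) + d *+ 2)%MM -> d m = 0 -> odd (num_gray c) = odd (num_gray d).
Proof.
move=> Dc dm; rewrite odd_num_gray_palindrome -size_filter /num_gray.
pose f u := u ++ m :: rev u.
rewrite -(size_map f (gray_words d)); congr (odd _); apply: perm_size.
have md u : content u = d -> m \notin u.
  by move=> Du; rewrite -has_pred1 has_count -contentE Du dm.
apply: uniq_perm.
- by rewrite filter_uniq // gray_words_uniq.
- rewrite map_inj_in_uniq ?gray_words_uniq // => u v.
  rewrite !mem_gray_words => /andP[_ /eqP Du] /andP[_ /eqP Dv] /eqP.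
  by rewrite eqseq_cat -?mdeg_content ?Du ?Dv // => /andP[/eqP].
move=> w; rewrite mem_filter mem_gray_words; apply/idP/mapP.
  case/and3P=> /eqP rw gw /eqP Dw.
  have w0 : w != [::].
    by apply: contra_eq_neq Dw => ->; rewrite content_nil Dc eq_sym mnmD_eq0 mnm1_eq0.
  have [u [m' [Du mu gu]]] := gray_rev_fixed gw rw w0.
  have Eu i : (m == i) + (d i).*2 = content u i + ((m' == i) + content u i).
    have := congr1 (fun c : 'X_{1..k} => c i) Dw.
    by rewrite Du Dc content_cat content_cons content_rev mnm_U1D2E !mnmDE !mnm1E.
  have Em : m' = m.
    by have := Eu m; rewrite eqxx dm; case: eqVneq => //= _; lia.
  rewrite Em in Du mu Eu *; exists u => //.
  rewrite mem_gray_words gu /=; apply/eqP/mnmP=> i; have := Eu i; lia.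
case=> u; rewrite mem_gray_words => /andP[gu /eqP ctu] ->.
have mu := md _ ctu.
rewrite /f rev_cat rev_cons revK cat_rcons eqxx /=.
rewrite gray_cat_cons ?mem_rev ?gray_rev //=.
apply/eqP/mnmP => i.
by rewrite Dc content_cat content_cons content_rev ctu mnm_U1D2E !mnmDE mnm1E; lia.
Qed.

Lemma odd_num_gray_inv c : odd (num_gray c) ->
  c = 0%MM \/ exists m d, c = (U_(m) + d *+ 2)%MM /\ d m = 0.
Proof.
rewrite odd_num_gray_palindrome => oc.
have: has (fun w => rev w == w) (gray_words c) by rewrite has_count; case: count oc.
case/hasP=> w; rewrite mem_gray_words => /andP[gw /eqP <-] /eqP rw.
have [->|w0] := eqVneq w [::]; first by left; rewrite content_nil.
have [u [m [-> mu gu]]] := gray_rev_fixed gw rw w0.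
right; exists m, (content u); split; last by rewrite contentE; apply/count_memPn.
by apply/mnmP=> i; rewrite content_cat content_cons content_rev mnm_U1D2E !mnmDE mnm1E; lia.
Qed.

Lemma num_gray0 : num_gray 0%MM = 1.
Proof.
rewrite /num_gray (perm_size (_ : perm_eq _ [:: [::]])) //.
apply: uniq_perm; rewrite ?gray_words_uniq // => w.
rewrite mem_gray_words inE; apply/andP/eqP => [[_ /eqP e]|->].
  by apply/nilP; rewrite /nilp -mdeg_content e mdeg0.
by rewrite gray_nil content_nil.
Qed.

(** The content giving the letters of [s] the values 1, 2, 4, ... in the order of
[s], and 0 to the other letters. *)
Definition geom s : 'X_{1..k} :=
  [multinom if i \in s then 2 ^ index i s else 0 | i < k].

Lemma geom_cons m s : m \notin s -> geom (m :: s) = (U_(m) + geom s *+ 2)%MM.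
Proof.
move=> ms; apply/mnmP=> i; rewrite mnm_U1D2E !mnmE inE /= [m == i]eq_sym.
case: eqVneq => [->|im] /=; first by rewrite (negPf ms).
by case: ifP; rewrite ?expnS ?mul2n.
Qed.

(** Contents of an odd number of gray words, for short odd contents, are found by
repeated halving: such a content is 0, or a letter of multiplicity 1 added
to the double of an odd content that avoids it. *)
Lemma odd_num_grayP c : odd (num_gray c) <-> exists2 s, uniq s & c = geom s.
Proof.
split.
  have [n] := ubnP (mdeg c); elim: n c => // n IHn c /ltnSE le_c oc.
  case: (odd_num_gray_inv oc) => [->|[m [d [Dc dm]]]].
    by exists [::] => //; apply/mnmP=> i; rewrite mnm0E mnmE.
  case: (IHn d) => [|| s Us Ds].
  - by apply: leq_trans le_c; rewrite Dc mdegD mdeg1 mdegMn; lia.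
  - by rewrite -(odd_num_gray_double Dc dm).
  have ms : m \notin s.
    by apply/negP=> ms; move: dm; rewrite Ds mnmE ms => /eqP; rewrite expn_eq0.
  by exists (m :: s); rewrite ?geom_cons -?Ds //= ms.
case=> s Us ->; elim: s Us => [_|m s IHs /= /andP[ms Us]].
  suff -> : geom [::] = 0%MM by rewrite num_gray0.
  by apply/mnmP=> i; rewrite !mnmE.
by rewrite (odd_num_gray_double (geom_cons ms)) ?IHs // mnmE (negPf ms).
Qed.

End Content.

(** * The Dickson polynomial over the field with two elements *)

Section VanishingOrder.
Local Open Scope ring_scope.
Variables (k : nat) (R : comNzRingType).
Implicit Types (i : 'I_k) (F G : {mpoly R[k]}).

(** [F] is divisible by the [a]-th power of the variable ['X_i]. *)
Definition vanishes i (a : nat) F := forall m : 'X_{1..k}, (m i < a)%N -> F@_m = 0.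

Lemma vanishes_weaken i a b F : (a <= b)%N -> vanishes i b F -> vanishes i a F.
Proof. by move=> ab h m ma; apply: h; apply: leq_trans ab. Qed.

Lemma vanishes0 i F : vanishes i 0 F. Proof. by []. Qed.

Lemma vanishesD i a F G : vanishes i a F -> vanishes i a G -> vanishes i a (F + G).
Proof. by move=> hF hG m ma; rewrite mcoeffD hF ?hG ?addr0. Qed.

Lemma vanishes_sum i a (I : Type) (r : seq I) (P : pred I) (F : I -> {mpoly R[k]}) :
  (forall j, P j -> vanishes i a (F j)) -> vanishes i a (\sum_(j <- r | P j) F j).
Proof.
move=> h; elim/big_rec: _ => [m _|j G Pj hG]; first by rewrite mcoeff0.
by apply: vanishesD => //; apply: h.
Qed.

Lemma vanishesM i a b F G : vanishes i a F -> vanishes i b G -> vanishes i (a + b) (F * G).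
Proof.
move=> hF hG m ma; rewrite mcoeffM big1 // => -[/= m1 m2] /eqP Dm.
have [lt|ge] := ltnP (m1 i) a; first by rewrite hF ?mul0r.
rewrite [X in _ * X]hG ?mulr0 //; have: m i = (m1 i + m2 i)%N by rewrite {1}Dm mnmDE.
by move: ma ge; lia.
Qed.

Lemma vanishes_exp i a n F : vanishes i a F -> vanishes i (a * n) (F ^+ n).
Proof.
move=> hF; elim: n => [|n IHn]; first by rewrite muln0.
by rewrite mulnS exprS; apply: vanishesM.
Qed.

Lemma vanishes_X i a : vanishes i a ('X_i ^+ a).
Proof.
move=> m ma; rewrite mpolyXn mcoeffX; case: eqP => // Dm.
by move: ma; rewrite -Dm mulmnE mnm1E eqxx mul1n ltnn.
Qed.

End VanishingOrder.

Section Dickson.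
Local Open Scope ring_scope.
Variable k : nat.
Notation F2poly := {mpoly 'F_2[k]}.
Implicit Types (S : {set 'I_k}) (F G : F2poly).

Lemma F2_pchar : 2%N \in [pchar F2poly].
Proof.
rewrite inE /= -mpolyC_nat; apply/eqP.
have -> : 2%:R = 0 :> 'F_2 by apply/val_inj.
exact: mpolyC0.
Qed.

Lemma F2_expr2n_sum (I : Type) (r : seq I) (P : pred I) (F : I -> F2poly) n :
  (\sum_(j <- r | P j) F j) ^+ (2 ^ n) = \sum_(j <- r | P j) F j ^+ (2 ^ n).
Proof.
elim/big_rec2: _ => [|j G H _ <-]; first by rewrite expr0n expn_eq0.
by rewrite exprDn_pchar // pnatX pnatE // F2_pchar.
Qed.

Lemma F2_sqr_sum (I : Type) (r : seq I) (P : pred I) (F : I -> F2poly) :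
  (\sum_(j <- r | P j) F j) ^+ 2 = \sum_(j <- r | P j) F j ^+ 2.
Proof. exact: (F2_expr2n_sum r P F 1). Qed.

Lemma F2_sqr_X F : F ^+ 2 = \sum_(m <- msupp F) 'X_[m *+ 2].
Proof.
rewrite {1}[F]mpolyE F2_sqr_sum.
rewrite big_seq [RHS]big_seq; apply: eq_bigr => m.
rewrite mcoeff_msupp exprZn mpolyXn => Fm.
suff -> : F@_m ^+ 2 = 1 by rewrite scale1r.
by case: (F@_m) Fm => [[|[|]]] //= ? _; apply/val_inj.
Qed.

Lemma mcoeff_sqr F m : (F ^+ 2)@_(m *+ 2) = F@_m.
Proof.
rewrite F2_sqr_X raddf_sum /=.
under eq_bigr => m' _ do rewrite mcoeffX.
have E m' : ((m' *+ 2)%MM == (m *+ 2)%MM) = (m' == m).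
  apply/eqP/eqP => [e|-> //]; apply/mnmP=> i.
  by have := congr1 (fun c : 'X_{1..k} => c i) e; rewrite !mulmnE; lia.
under eq_bigr => m' _ do rewrite E.
have [mF|mF] := boolP (m \in msupp F).
  rewrite (bigD1_seq m) ?msupp_uniq //= eqxx big1 => [|i /negPf -> //].
  rewrite addr0; move: mF; rewrite mcoeff_msupp.
  by case: (F@_m) => [[|[|]]] //= ? _; apply/val_inj.
rewrite memN_msupp_eq0 // big_seq big1 // => m' m'F.
by case: eqP mF => // <-; rewrite m'F.
Qed.

Lemma mcoeff_sqr_odd F c : (F ^+ 2)@_c != 0 -> exists m, c = (m *+ 2)%MM.
Proof.
rewrite F2_sqr_X raddf_sum /=.
have [/hasP[m _ /eqP <-]|] := boolP (has (fun m => (m *+ 2)%MM == c) (msupp F)).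
  by exists m.
move/hasPn=> h; rewrite big_seq big1 ?eqxx // => m /h.
by rewrite mcoeffX => /negPf ->.
Qed.

(** The Dickson polynomial of the variables in [S], defined by its expansion along
the variable of exponent 1; the fuel [n] stands for the size of [S]. *)
Fixpoint dickson_rec n S : F2poly :=
  if n is n'.+1 then \sum_(m in S) 'X_m * dickson_rec n' (S :\ m) ^+ 2 else 1.

Definition dickson S := dickson_rec #|S| S.

Lemma dickson0 : dickson set0 = 1.
Proof. by rewrite /dickson cards0. Qed.

Lemma dickson_low S : S != set0 -> dickson S = \sum_(m in S) 'X_m * dickson (S :\ m) ^+ 2.
Proof.
rewrite -card_gt0 /dickson; case DS: #|S| => [//|n] _ /=.
by apply: eq_bigr => m mS; have := cardsD1 m S; rewrite DS mS => -[->].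
Qed.

(** The letters of positive multiplicity. *)
Definition supp (c : 'X_{1..k}) : {set 'I_k} := [set i | c i != 0%N].

Lemma coef_XU_sqr m F c : ('X_m * F ^+ 2)@_c != 0 ->
  exists d, c = (U_(m) + d *+ 2)%MM /\ F@_d != 0.
Proof.
have [c0|cm] := posnP (c m).
  by rewrite (vanishesM (@vanishes_X k _ m 1) (@vanishes0 _ _ m _)) ?c0 ?eqxx.
have -> : c = (c - U_(m) + U_(m))%MM by rewrite submK // lep1mP -lt0n.
rewrite ['X_m * _]mulrC [X in _@_X]addmC mcoeffMX => nz.
have [d Dd] := mcoeff_sqr_odd nz.
by exists d; rewrite Dd mcoeff_sqr addmC in nz *.
Qed.

(** The coefficients satisfy the recursion that governs the parity of the number of
gray words. *)
Lemma dickson_coef S c : (dickson S)@_c = (odd (num_gray c) && (supp c == S))%:R.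
Proof.
have [n] := ubnP #|S|; elim: n S c => // n IHn S c /ltnSE le_S.
have [->|S0] := eqVneq S set0.
  rewrite dickson0 mcoeff1; congr (_%:R); congr nat_of_bool.
  apply/eqP/andP => [->|[_ /eqP c0]].
    rewrite num_gray0; split=> //; apply/eqP/setP=> i; rewrite !inE.
    by rewrite mnm0E.
  apply/mnmP=> i; rewrite mnm0E; have := in_set0 i.
  by rewrite -c0 inE; case: (c i).
rewrite dickson_low // raddf_sum /=.
have IH m d : m \in S -> (dickson (S :\ m))@_d = (odd (num_gray d) && (supp d == S :\ m))%:R.
  by move=> mS; apply: IHn; move: le_S; rewrite (cardsD1 m) mS.
have low m d c' : m \in S -> c' = (U_(m) + d *+ 2)%MM -> supp d = S :\ m ->
    d m = 0%N /\ supp c' = S.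
  move=> mS Dc' Sd; have dm : d m = 0%N.
    by apply/eqP; have := in_set (fun i => d i != 0%N) m; rewrite -/(supp d) Sd !inE eqxx; case: eqP.
  split=> //; apply/setP=> i; rewrite inE Dc' mnm_U1D2E.
  have [<-|im] := eqVneq m i; first by rewrite mS.
  by have := in_set (fun i => d i != 0%N) i; rewrite -/(supp d) Sd !inE eq_sym im double_eq0 => /= <-.
have [/andP[oc /eqP Sc]|noc] := boolP (_ && _).
  case: (odd_num_gray_inv oc) => [c0|[m [d [Dc dm]]]].
    case/eqP: S0; rewrite -Sc c0; apply/setP=> i; rewrite !inE.
    by rewrite mnm0E.
  have mS : m \in S by rewrite -Sc inE Dc mnm_U1D2E eqxx.
  have Sd : supp d = S :\ m.
    apply/setP=> i; rewrite !inE -Sc inE Dc mnm_U1D2E.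
    have [->|im] := eqVneq i m; first by rewrite dm.
    by rewrite add0n double_eq0.
  rewrite (bigD1 m) //= {1}Dc ['X_m * _]mulrC mcoeffMX mcoeff_sqr IH //.
  rewrite -(odd_num_gray_double Dc dm) oc Sd eqxx big1 ?addr0 // => m' /andP[_ m'm].
  apply/eqP/negPn/negP=> /coef_XU_sqr[d' [Dc' _]].
  have := congr1 (fun c : 'X_{1..k} => odd (c m)) (etrans (esym Dc) Dc').
  by rewrite !mnm_U1D2E !oddD !odd_double eqxx (negPf m'm).
rewrite big1 // => m mS; apply/eqP/negPn/negP=> /coef_XU_sqr[d [Dc]].
rewrite IH //; case: andP => [[od /eqP Sd] _|]; last by rewrite eqxx.
have [dm Sc] := low m d c mS Dc Sd.
by rewrite (odd_num_gray_double Dc dm) od Sc eqxx in noc.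
Qed.

(** The expansion along the variable of highest exponent. *)
Lemma dickson_top S : S != set0 ->
  dickson S = \sum_(m in S) 'X_m ^+ (2 ^ #|S|.-1) * dickson (S :\ m).
Proof.
have [n] := ubnP #|S|; elim: n S => // n IHn S /ltnSE le_S S0.
rewrite dickson_low //.
have [/cards1P[m ->]|S1] := boolP (#|S| == 1%N).
  by rewrite !big_set1 cards1 setDv dickson0 expr1n.
have card1 m : m \in S -> #|S| = #|S :\ m|.+1 by move=> mS; rewrite (cardsD1 m) mS.
have IH m : m \in S -> 'X_m * dickson (S :\ m) ^+ 2 =
    \sum_(m' in S | m' != m) 'X_m' ^+ (2 ^ #|S|.-1) * ('X_m * dickson (S :\ m :\ m') ^+ 2).
  move=> mS; rewrite IHn.
  - rewrite F2_sqr_sum mulr_sumr.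
    apply: eq_big => [m'|m' m'S]; first by rewrite !inE andbC.
    rewrite exprMn -exprM mulrCA; congr (_ ^+ _ * _).
    by rewrite (card1 m mS) /= -expnSr prednK // card_gt0; apply/set0Pn; exists m'.
  - by move: le_S; rewrite (card1 m).
  - by move: S1; rewrite (card1 m mS) eqSS cards_eq0.
rewrite (eq_bigr _ IH) (exchange_big_dep (mem S)) //=; last by move=> ? ? _ /andP[].
apply: eq_bigr => m' m'S; rewrite dickson_low; last first.
  by move: S1; rewrite (card1 m' m'S) eqSS cards_eq0.
rewrite mulr_sumr; apply: eq_big => [m|m _]; first by rewrite !inE m'S eq_sym andbC.
by rewrite setDDl setUC -setDDl.
Qed.

Lemma dickson_vanishes S i : i \in S -> vanishes i 1 (dickson S).
Proof.
move=> iS c; rewrite ltnS leqn0 => /eqP ci; rewrite dickson_coef.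
case: eqP => [Sc|]; last by rewrite andbF.
by move: iS; rewrite -Sc inE ci.
Qed.

(** The monomial is built one variable at a time: the new variable [s] gets the
exponent [2 ^ (n + #|S| - 1) + r], and what remains is a monomial of
[dickson (S :\ s) ^+ (2 ^ n + 2 * r)]. The factor 2 in the bound avoids a
subtraction in the exponent. *)
Lemma dickson_witness S n r : (r < 2 ^ n)%N -> exists m : 'X_{1..k},
  [/\ forall i, i \notin S -> m i = 0%N,
      forall i, i \in S -> (2 * m i <= 2 ^ (n + #|S|) + 2 * r)%N
    & (dickson S ^+ (2 ^ n + r))@_m != 0].
Proof.
have [N] := ubnP #|S|; elim: N S n r => // N IHN S n r /ltnSE le_S lt_r.
have [->|/set0Pn[s sS]] := eqVneq S set0.
  exists 0%MM; rewrite dickson0 expr1n mcoeff1 eqxx; split=> // i.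
  - by rewrite mnm0E.
  - by rewrite inE.
set T := S :\ s.
have cS : #|S| = #|T|.+1 by rewrite (cardsD1 s) sS.
have S0 : S != set0 by rewrite -card_gt0 cS.
pose a := (2 ^ (n + #|T|))%N.
have [m [m0 mle mT]] : exists m : 'X_{1..k},
  [/\ forall i, i \notin T -> m i = 0%N,
      forall i, i \in T -> (m i < a + r)%N & (dickson T ^+ (2 ^ n + 2 * r))@_m != 0].
  have leT : (#|T| < N)%N by rewrite -cS.
  (* Write 2^n + 2r again as a power of 2 plus a smaller remainder: the leading
     exponent stays n, or becomes n + 1 when 2r >= 2^n. *)
  have [lt|ge] := ltnP (2 * r) (2 ^ n).
    have [m [m0 mle mT]] := IHN T n (2 * r)%N leT lt.
    exists m; split=> // i iT; have := mle i iT; rewrite -/a => mi.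
    have : (2 ^ n * 2 <= a)%N.
      by rewrite -expnSr leq_exp2l // -addn1 leq_add2l card_gt0; apply/set0Pn; exists i.
    by lia.
  have lt' : (2 * r - 2 ^ n < 2 ^ n.+1)%N by rewrite expnS; lia.
  have [m [m0 mle mT]] := IHN T n.+1 (2 * r - 2 ^ n)%N leT lt'.
  exists m; split=> // [i iT|].
    by have := mle i iT; rewrite addSn expnS -/a; move: ge lt_r; lia.
  by move: mT; congr ((_ ^+ _)@__ != 0); rewrite expnS; move: ge; lia.
exists (m + U_(s) *+ (a + r))%MM.
have sT : s \notin T by rewrite !inE eqxx.
have mE i : (m + U_(s) *+ (a + r))%MM i = (m i + (s == i) * (a + r))%N.
  by rewrite mnmDE mulmnE mnm1E.
have m's : (m + U_(s) *+ (a + r))%MM s = (a + r)%N by rewrite mE eqxx m0 // mul1n.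
have m'T i : i \in T -> (m + U_(s) *+ (a + r))%MM i = m i.
  by move=> iT; rewrite mE; case: eqP iT sT => [<- ->|]; rewrite ?mul0n ?addn0.
have ST i : i \in S -> i = s \/ i \in T.
  by move=> iS; rewrite !inE iS; case: eqP; [left|right].
split.
- move=> i iS; rewrite mE m0 ?inE ?(negPf iS) ?andbF //.
  by case: eqP iS => [<-|]; rewrite ?sS // mul0n.
- have aE : (2 ^ (n + #|S|) = 2 * a)%N by rewrite cS addnS expnS.
  move=> i /ST[->|iT]; rewrite ?m's ?m'T // aE ?mulnDr //.
  by have := mle i iT; lia.
(* The lowest power of X_s in dickson S ^+ r is X_s^r, with coefficient
   dickson T ^+ (2 * r). *)
have [E [DE vanE]] : exists E, dickson S ^+ r = 'X_s ^+ r * dickson T ^+ (2 * r) + E /\ vanishes s r.+1 E.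
  elim: (r) => [|q [E [IHq vanE]]]; first by exists 0; split; rewrite ?mulr1 ?addr0 // => ? _; rewrite mcoeff0.
  have [E1 [DE1 vanE1]] : exists E1, dickson S = 'X_s * dickson T ^+ 2 + E1 /\ vanishes s 2 E1.
    rewrite dickson_low // (bigD1 s) //=; eexists; split; first by [].
    apply: vanishes_sum => j /andP[jS js]; rewrite -[2%N]/(0 + 1 * 2)%N.
    apply: vanishesM => //; apply: vanishes_exp; apply: dickson_vanishes.
    by rewrite !inE eq_sym js.
  exists (E1 * ('X_s ^+ q * dickson T ^+ (2 * q)) + dickson S * E); split.
    rewrite exprS IHq mulrDr {1}DE1 mulrDl mulnS ['X_s ^+ q.+1]exprS exprD -addrA.
    by congr (_ + _); rewrite mulrACA.
  apply: vanishesD.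
    apply: (@vanishes_weaken _ _ _ _ (2 + (q + 0))); first by rewrite addn0.
    by apply: vanishesM => //; apply: vanishesM => //; apply: vanishes_X.
  exact: (@vanishesM _ _ s 1 q.+1 _ _ (dickson_vanishes sS) vanE).
have -> : dickson S ^+ (2 ^ n + r) =
    'X_[U_(s) *+ (a + r)] * dickson T ^+ (2 ^ n + 2 * r) + 'X_s ^+ a * dickson T ^+ (2 ^ n) * E
    + \sum_(i in T) ('X_i ^+ a * dickson (S :\ i) ^+ (2 ^ n)) * dickson S ^+ r.
  rewrite -mulr_suml exprD {1}dickson_top // F2_expr2n_sum (bigD1 s) //= mulrDl.
  congr (_ + _).
    rewrite DE mulrDr exprMn -exprM cS /= -expnD addnC -/a -/T; congr (_ + _).
    by rewrite -mpolyXn !exprD mulrACA.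
  congr (_ * _); apply: eq_big => [i|i _]; first by rewrite !inE andbC.
  by rewrite exprMn -exprM cS /= -expnD addnC.
(* Of the three terms, the second has degree in X_s larger than a + r, and the
   third has degree at least a + r in some X_i, i in T, where m i < a + r. *)
rewrite !mcoeffD [X in _ + X + _](_ : _ = 0) ?addr0; last first.
  apply: (vanishesM (vanishesM (@vanishes_X _ _ s a) (@vanishes0 _ _ s _)) vanE).
  by rewrite m's addn0 addnS.
rewrite [X in _ + X](_ : _ = 0) ?addr0; last first.
  rewrite raddf_sum big1 // => i iT /=.
  have iS : i \in S by move: iT; rewrite inE => /andP[].
  have h := vanishesM (vanishesM (@vanishes_X _ 'F_2 i a) (@vanishes0 _ _ i (dickson (S :\ i) ^+ (2 ^ n))))
    (vanishes_exp (n:=r) (dickson_vanishes iS)).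
  by apply: h; rewrite addn0 mul1n m'T // mle.
by rewrite [(m + _)%MM]addmC [_ * dickson T ^+ _]mulrC mcoeffMX.
Qed.

(** Every monomial of [dickson S ^+ (2 ^ n)] contains the power
[2 ^ (n + #|S| - 1)] of some variable. *)
Lemma dickson_lower S n r F m : S != set0 -> (forall i, i \in S -> vanishes i r F) ->
    (dickson S ^+ (2 ^ n) * F)@_m != 0 ->
  exists2 i, i \in S & (2 ^ (n + #|S|.-1) + r <= m i)%N.
Proof.
move=> S0 vanF; have [/exists_inP[i iS le_i] _|h] :=
  boolP [exists i in S, (2 ^ (n + #|S|.-1) + r <= m i)%N]; first by exists i.
rewrite dickson_top // F2_expr2n_sum mulr_suml raddf_sum big1 ?eqxx // => i iS /=.
rewrite exprMn -exprM -expnD addnC.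
have h' := vanishesM (vanishesM (@vanishes_X _ 'F_2 i (2 ^ (n + #|S|.-1)))
   (@vanishes0 _ _ i (dickson (S :\ i) ^+ (2 ^ n)))) (vanF i iS).
apply: h'; rewrite addn0 ltnNge; apply: contraNN h => le_i.
by apply/exists_inP; exists i.
Qed.

End Dickson.

(** * Generating polynomials of gray words, modulo 2 and modulo 4 *)

Section Geom.
Variable k : nat.
Implicit Types (s : seq 'I_k) (c : 'X_{1..k}).

Lemma mdeg_geom s : uniq s -> mdeg (geom s) = (2 ^ size s).-1.
Proof.
elim: s => [_|m s IHs /= /andP[ms Us]].
  by apply/eqP; rewrite mdeg_eq0; apply/eqP/mnmP=> i; rewrite !mnmE.
rewrite geom_cons // mdegD mdeg1 mdegMn IHs // expnS.
by have := expn_gt0 2 (size s); lia.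
Qed.

Lemma supp_geom s : supp (geom s) = [set i in s].
Proof. by apply/setP=> i; rewrite !inE mnmE; case: (i \in s); rewrite ?expn_eq0. Qed.

Lemma geom_val s i : geom s i = 0 \/ exists e, geom s i = 2 ^ e.
Proof. by rewrite mnmE; case: ifP; [right; eexists | left]. Qed.

Lemma geom_inj s i j : geom s i != 0 -> geom s i = geom s j -> i = j.
Proof.
rewrite !mnmE; case: ifP => // si _; case: ifP => [sj|_ /eqP]; last by rewrite expn_eq0.
by move/eqP; rewrite eqn_exp2l // => /eqP /(congr1 (nth i s)); rewrite !nth_index.
Qed.

Lemma geom_le_supp s i e : uniq s -> geom s i = 2 ^ e -> e < #|supp (geom s)|.
Proof.
move=> Us; rewrite supp_geom cardsE (card_uniqP Us) mnmE; case: ifP => [si|_ /eqP].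
  by move/eqP; rewrite eqn_exp2l // => /eqP <-; rewrite index_mem.
by rewrite eq_sym expn_eq0.
Qed.

(** For an odd content, full length and full support are the same condition. *)
Lemma odd_num_gray_supp c : odd (num_gray c) -> (mdeg c == (2 ^ k).-1) = (supp c == setT).
Proof.
case/odd_num_grayP=> s Us ->; rewrite mdeg_geom // supp_geom.
have -> : ([set i in s] == setT) = (size s == k).
  rewrite eqEcard subsetT /= cardsT card_ord cardsE (card_uniqP Us) eqn_leq.
  suff -> : size s <= k by [].
  by rewrite -(card_uniqP Us) -[leqRHS]card_ord max_card.
have := expn_gt0 2 (size s); have := expn_gt0 2 k => /= h1 h2.
rewrite -[RHS](eqn_exp2l (m := 2)) //; apply/eqP/eqP; lia.
Qed.

End Geom.

Section GrayPoly.
Local Open Scope ring_scope.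
Variables (k : nat) (R : comNzRingType).

(** The generating polynomial, by content, of the transition words of [k]-bit Gray
codes. *)
Definition gray_poly : {mpoly R[k]} :=
  \sum_(t : (2 ^ k).-1.-tuple 'I_k | gray t) 'X_[content t].

Lemma card_gray_tuples (c : 'X_{1..k}) :
  #|[set t : (2 ^ k).-1.-tuple 'I_k | gray t & content t == c]| =
    if mdeg c == (2 ^ k).-1 then num_gray c else 0%N.
Proof.
case: eqP => [Dc|Dc]; last first.
  apply: eq_card0 => t; rewrite !inE; apply/andP=> -[_ /eqP Dt].
  by case: Dc; rewrite -Dt mdeg_content size_tuple.
rewrite cardE /num_gray -(size_map val); apply: perm_size; apply: uniq_perm.
- by rewrite map_inj_uniq ?enum_uniq //; apply: val_inj.
- exact: gray_words_uniq.
move=> w; rewrite mem_gray_words; apply/mapP/idP => [[t]|].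
  by rewrite mem_enum inE => /andP[gt ctt] ->; rewrite gt.
case/andP=> gw /eqP cw; have sw : size w == (2 ^ k).-1 by rewrite -mdeg_content cw Dc.
by exists (Tuple sw) => //; rewrite mem_enum inE /= gw cw eqxx.
Qed.

Lemma gray_poly_coef c :
  gray_poly@_c = (if mdeg c == (2 ^ k).-1 then num_gray c else 0%N)%:R.
Proof.
rewrite -card_gray_tuples raddf_sum /= -sum1_card natr_sum.
rewrite [RHS](eq_bigl (fun t : (2 ^ k).-1.-tuple 'I_k => gray t && (content t == c))).
  by rewrite big_mkcondr; apply: eq_bigr => t _; rewrite mcoeffX; case: eqP.
by move=> t; rewrite inE.
Qed.

End GrayPoly.

Section ResidueRings.
Local Open Scope ring_scope.

Lemma F2_natr_odd n : n%:R = (odd n)%:R :> 'F_2.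
Proof. by apply/val_inj; rewrite /= !val_Fp_nat // !modn2 oddb. Qed.

Lemma gray_poly_F2 k : gray_poly k 'F_2 = dickson setT.
Proof.
apply/mpolyP=> c; rewrite gray_poly_coef dickson_coef F2_natr_odd.
case: ifP => [Dc|Dc]; case oc: (odd (num_gray c)) => //=; rewrite -odd_num_gray_supp ?oc ?Dc //.
Qed.

End ResidueRings.

Section ModFour.
Local Open Scope ring_scope.
Variables (k : nat) (R : comNzRingType).
Hypothesis R4 : 4%:R = 0 :> R.
Implicit Types (M L : seq 'X_{1..k}) (A Q : {mpoly R[k]}).

(** The monomials that occur an odd number of times in a list. *)
Definition odd_part M := [seq m <- undup M | odd (count_mem m M)].

Lemma sumX_odd_part M : exists Q,
  \sum_(m <- M) 'X_[m] = \sum_(m <- odd_part M) 'X_[m] + Q *+ 2 :> {mpoly R[k]}.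
Proof.
exists (\sum_(m <- undup M) 'X_[m] *+ (count_mem m M)./2).
rewrite big_filter -big_undup_iterop_count /= -sumrMnl [X in X + _]big_mkcond -big_split /=.
apply: eq_bigr => m _; rewrite -{1}[count_mem m M]odd_double_half.
have -> n : iterop n +%R ('X_[m] : {mpoly R[k]}) 0 = 'X_[m] *+ n.
  by elim: n => // -[|n] //= ->; rewrite -mulrS.
by rewrite mulrnDr -mulrnA muln2; case: odd.
Qed.

(** Squaring turns a congruence modulo 2 into a congruence modulo 4. *)
Lemma sqr_mod4 A Q : (A + Q *+ 2) ^+ 2 = A ^+ 2.
Proof.
have Q4 : Q * A *+ 4 = 0 /\ Q ^+ 2 *+ 4 = 0.
  by split; rewrite -[_ *+ 4]mulr_natr -mpolyC_nat R4 mpolyC0 mulr0.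
case: Q4 => e1 e2.
have -> : (A + Q *+ 2) ^+ 2 = A ^+ 2 + Q * A *+ 4 + Q ^+ 2 *+ 4 by ring.
by rewrite e1 e2 !addr0.
Qed.

Lemma sumX_sqr L a : exists Q,
  (\sum_(m <- L) 'X_[m *+ a]) ^+ 2 = \sum_(m <- L) 'X_[m *+ (2 * a)] + Q *+ 2 :> {mpoly R[k]}.
Proof.
elim: L => [|m L [Q IHL]]; first by exists 0; rewrite !big_nil expr0n mul0rn addr0.
exists (Q + 'X_[m *+ a] * (\sum_(m <- L) 'X_[m *+ a])).
rewrite !big_cons sqrrD IHL mpolyXn.
have -> : (m *+ a *+ 2)%MM = (m *+ (2 * a))%MM.
  by apply/mnmP=> i; rewrite !mulmnE mulnAC mulnA mulnAC.
by ring.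
Qed.

Lemma sumX_exp2n M n :
  (\sum_(m <- M) 'X_[m]) ^+ (2 ^ n.+1) =
  (\sum_(m <- odd_part M) 'X_[m *+ 2 ^ n]) ^+ 2 :> {mpoly R[k]}.
Proof.
elim: n => [|n IHn].
  have [Q ->] := sumX_odd_part M; rewrite expn1 sqr_mod4.
  by congr (_ ^+ 2); apply: eq_bigr => m _.
rewrite expnSr exprM IHn.
by have [Q ->] := sumX_sqr (odd_part M) (2 ^ n); rewrite sqr_mod4 expnS.
Qed.

Lemma sumX_sqr_coef L a (mu : 'X_{1..k}) : (0 < a)%N ->
  ((\sum_(m <- L) 'X_[m *+ a]) ^+ 2 : {mpoly R[k]})@_(mu *+ a) =
  (count (fun p => p.1 + p.2 == mu)%MM [seq (c1, c2) | c1 <- L, c2 <- L])%:R.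
Proof.
move=> a0; rewrite expr2 mulr_suml raddf_sum /= -sum1_count natr_sum [RHS]big_mkcond big_allpairs.
apply: eq_bigr => c1 _; rewrite mulr_sumr raddf_sum; apply: eq_bigr => c2 _ /=.
rewrite -mpolyXD mcoeffX; have -> : ((c1 *+ a + c2 *+ a)%MM == (mu *+ a)%MM) = ((c1 + c2)%MM == mu).
  apply/eqP/eqP => [e|<-]; apply/mnmP=> i; last by rewrite mulmnE !mnmDE !mulmnE mulnDl.
  have := congr1 (fun c : 'X_{1..k} => c i) e; rewrite !mnmDE !mulmnE -mulnDl.
  by move/eqP; rewrite eqn_pmul2r // => /eqP.
by case: eqP.
Qed.

End ModFour.

Section IntegersModFour.
Local Open Scope ring_scope.

Lemma Z4_natr4 : 4%:R = 0 :> 'Z_4.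
Proof. exact/val_inj. Qed.

Lemma Z4_natr_inj n m : n%:R = m%:R :> 'Z_4 -> (n = m %[mod 4])%N.
Proof. by move/(congr1 val); rewrite /= !val_Zp_nat. Qed.

End IntegersModFour.

Section Split.
Variable k : nat.
Implicit Types (s : nat) (c : 'X_{1..k}).

(** The [s] first letters. *)
Definition below s : {set 'I_k} := [set i : 'I_k | i < s].

(** The first and the last of the [s] first letters. *)
Definition ends s (i : nat) := (i == 0) || (i == s.-1).

(** The sum of [up s] and [swapped s], spelled out. *)
Definition mu s : 'X_{1..k} :=
  [multinom if ends s i then (2 ^ s.-1).+1 else if i < s then 2 ^ i.+1 else 0 | i < k].

(** The content 1, 2, 4, ... on the [s] first letters. *)
Definition up s : 'X_{1..k} := [multinom if i < s then 2 ^ i else 0 | i < k].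

(** The content [up s] with the values of the first and the last letter exchanged. *)
Definition swapped s : 'X_{1..k} :=
  [multinom if val i == 0 then 2 ^ s.-1 else if val i == s.-1 then 1
            else if i < s then 2 ^ i else 0 | i < k].

Lemma pow2_sum_odd x y e : 0 < e ->
    (x = 0 \/ exists a, x = 2 ^ a) -> (y = 0 \/ exists a, y = 2 ^ a) ->
  x + y = (2 ^ e).+1 -> (x = 1 /\ y = 2 ^ e) \/ (x = 2 ^ e /\ y = 1).
Proof.
move=> e0 hx hy exy.
have o z : (z = 0 \/ exists a, z = 2 ^ a) -> odd z -> z = 1.
  by case=> [->|[[|a] ->]] //; rewrite oddX.
have: odd (x + y) by rewrite exy /= oddX; case: e e0 {exy}.
rewrite oddD; case ox: (odd x); case oy: (odd y) => // _.
  by left; have x1 := o x hx ox; split=> //; move: exy; rewrite x1 => -[].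
by right; have y1 := o y hy oy; split=> //; move: exy; rewrite y1 addn1 => -[].
Qed.

Lemma pow2_sum_even x y e :
    (x = 0 \/ exists a, x = 2 ^ a) -> (y = 0 \/ exists a, y = 2 ^ a) ->
    x != 0 -> y != 0 -> x + y = 2 ^ e.+1 -> x = 2 ^ e /\ y = 2 ^ e.
Proof.
have h z t : (z = 0 \/ exists a, z = 2 ^ a) -> z != 0 -> t != 0 -> z + t = 2 ^ e.+1 -> z <= 2 ^ e.
  case=> [-> //|[a ->]] _ t0 ezt; rewrite leq_exp2l // -ltnS -(ltn_exp2l (m := 2)) //.
  by rewrite -ezt -[ltnLHS]addn0 ltn_add2l lt0n.
move=> hx hy x0 y0 exy.
have := h x y hx x0 y0 exy; have := h y x hy y0 x0 (etrans (addnC y x) exy).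
by move: exy; rewrite expnS; lia.
Qed.

Lemma geom_pair_unique s c1 c2 : 2 <= s <= k -> odd (num_gray c1) -> odd (num_gray c2) ->
    (c1 + c2)%MM = mu s ->
  (c1 = up s /\ c2 = swapped s) \/ (c1 = swapped s /\ c2 = up s).
Proof.
case/andP=> s2 sk /odd_num_grayP[s1 U1 D1] /odd_num_grayP[s2' U2 D2] Dmu.
have k0 : 0 < k by lia.
have kB : s.-1 < k by lia.
pose A := Ordinal k0; pose B := Ordinal kB.
have muE i : c1 i + c2 i = mu s i by rewrite -Dmu mnmDE.
have v1 i : c1 i = 0 \/ exists a, c1 i = 2 ^ a by rewrite D1; apply: geom_val.
have v2 i : c2 i = 0 \/ exists a, c2 i = 2 ^ a by rewrite D2; apply: geom_val.
have e0 : 0 < s.-1 by lia.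
have muA : mu s A = (2 ^ s.-1).+1 by rewrite mnmE.
have muB : mu s B = (2 ^ s.-1).+1 by rewrite mnmE /ends /= eqxx orbT.
have AB : A <> B by move/(congr1 val) => /=; lia.
(* A geometric content supported on the s first letters that reaches 2^(s-1)
   must use all of these letters. *)
have full c l : c = geom l -> uniq l -> (forall i : 'I_k, s <= i -> c i = 0) ->
    (exists i, c i = 2 ^ s.-1) -> forall i : 'I_k, i < s -> c i != 0.
  move=> Dc Ul c0 [i ci]; have le_s : s <= #|supp c|.
    by rewrite Dc in ci *; have := geom_le_supp Ul ci; lia.
  have sub : supp c \subset below s.
    by apply/subsetP=> j; rewrite !inE ltnNge; apply: contra => /c0 ->.
  have cb : #|below s| <= s.
    have sub' : below s \subset widen_ord sk @: setT.
      apply/subsetP=> j; rewrite inE => js.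
      by apply/imsetP; exists (Ordinal js) => //; apply/val_inj.
    apply: leq_trans (subset_leq_card sub') _.
    by apply: leq_trans (leq_imset_card _ _) _; rewrite cardsT card_ord.
  have /eqP eS : supp c == below s by rewrite eqEcard sub (leq_trans cb).
  move=> j js; have : j \in supp c by rewrite eS inE.
  by rewrite inE.
have mu0 (i : 'I_k) : s <= i -> mu s i = 0.
  move=> si; rewrite mnmE /ends ltnNge si /= ifF //.
  by apply/negbTE; rewrite negb_or; apply/andP; split; apply/eqP; lia.
have z1 (i : 'I_k) : s <= i -> c1 i = 0 by move/mu0 => mi; have := muE i; lia.
have z2 (i : 'I_k) : s <= i -> c2 i = 0 by move/mu0 => mi; have := muE i; lia.
have mid (i : 'I_k) : (exists i, c1 i = 2 ^ s.-1) -> (exists i, c2 i = 2 ^ s.-1) ->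
    i < s -> i != A -> i != B -> c1 i = 2 ^ i /\ c2 i = 2 ^ i.
  move=> x1 x2 is_ iA iB; apply: pow2_sum_even => //.
  - exact: full D1 U1 z1 x1 i is_.
  - exact: full D2 U2 z2 x2 i is_.
  rewrite muE mnmE /ends is_ -[val i == 0]/(i == A) -[val i == s.-1]/(i == B).
  by rewrite (negPf iA) (negPf iB).
have inj1 : c1 A = c1 B -> c1 A != 0 -> False by rewrite D1 => e /geom_inj /(_ e).
have inj2 : c2 A = c2 B -> c2 A != 0 -> False by rewrite D2 => e /geom_inj /(_ e).
have eqA := etrans (muE A) muA; have eqB := etrans (muE B) muB.
have fin (x y : 'X_{1..k}) : x A = 1 -> y A = 2 ^ s.-1 -> x B = 2 ^ s.-1 -> y B = 1 ->
    (forall i : 'I_k, s <= i -> x i = 0) -> (forall i : 'I_k, s <= i -> y i = 0) ->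
    (forall i : 'I_k, i < s -> i != A -> i != B -> x i = 2 ^ i /\ y i = 2 ^ i) ->
  x = up s /\ y = swapped s.
  move=> xA yA xB yB x0 y0 xy; split; apply/mnmP=> i.
    have [->|iA] := eqVneq i A; first by rewrite xA mnmE /= ifT //; lia.
    have [->|iB] := eqVneq i B; first by rewrite xB mnmE /= ifT //; lia.
    by rewrite mnmE; case: ltnP => [si|/x0 //]; case: (xy i si iA iB).
  have [->|iA] := eqVneq i A; first by rewrite yA mnmE.
  have [->|iB] := eqVneq i B.
    by rewrite yB mnmE /= eqxx (_ : (s.-1 == 0) = false) //; apply/eqP; lia.
  rewrite mnmE -[val i == 0]/(i == A) -[val i == s.-1]/(i == B) (negPf iA) (negPf iB).
  by case: ltnP => [si|/y0 //]; case: (xy i si iA iB).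
(* At A and at B one summand is 1 and the other 2^(s-1); the values of a
   geometric content are distinct, so the roles at A and B are opposite. *)
case: (pow2_sum_odd e0 (v1 A) (v2 A) eqA) => -[a1 a2];
  case: (pow2_sum_odd e0 (v1 B) (v2 B) eqB) => -[b1 b2].
- by case: inj1; rewrite a1 ?b1.
- left; apply: fin => // i; apply: mid; [by exists B | by exists A].
- right; case: (fin c2 c1) => // i si iA iB.
  by case: (mid i) => //; [exists A | exists B].
- by case: inj2; rewrite a2 ?b2.
Qed.

End Split.

(** * Two-part sums of geometric contents *)

Section Pairs.
Variable k : nat.
Implicit Types (s : nat) (c : 'X_{1..k}).

Lemma geom_map (p : 'S_k) (l : seq 'I_k) (i : 'I_k) :
  geom [seq p j | j <- l] (p i) = geom l i.
Proof.
by rewrite !mnmE mem_map ?index_map //; apply: perm_inj.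
Qed.

Lemma up_geom s : s <= k -> up k s = geom (take s (enum 'I_k)).
Proof.
move=> sk; apply/mnmP=> i; rewrite !mnmE in_take ?mem_enum // index_enum_ord.
case: ifP => // lt_is; congr (_ ^ _).
have := index_enum_ord i; rewrite -{1}[enum 'I_k](cat_take_drop s) index_cat.
by rewrite in_take ?mem_enum // index_enum_ord lt_is.
Qed.

Lemma odd_num_gray_up s : s <= k -> odd (num_gray (up k s)).
Proof.
move=> sk; apply/odd_num_grayP; exists (take s (enum 'I_k)); last exact: up_geom.
by rewrite take_uniq // enum_uniq.
Qed.

Lemma swapped_geom s : 2 <= s <= k ->
  exists l : seq 'I_k, [/\ uniq l, size l = s & swapped k s = geom l].
Proof.
case/andP=> s2 sk.
have k0 : 0 < k by lia.
have kB : s.-1 < k by lia.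
pose A := Ordinal k0; pose B := Ordinal kB.
have AB : A != B by apply/eqP=> /(congr1 val) /=; lia.
exists [seq tperm A B j | j <- take s (enum 'I_k)]; split.
- by rewrite map_inj_uniq ?take_uniq ?enum_uniq //; apply: perm_inj.
- by rewrite size_map size_takel // size_enum_ord.
apply/mnmP=> i; rewrite -[i in RHS](tpermK A B) geom_map -up_geom // !mnmE.
rewrite -[val i == 0]/(i == A) -[val i == s.-1]/(i == B).
case: tpermP => [->|->|/eqP /negPf-> /eqP /negPf-> //].
  by rewrite eqxx /= ifT //; lia.
by rewrite eqxx eq_sym (negPf AB) /= ifT //; lia.
Qed.

Lemma odd_num_gray_swapped s : 2 <= s <= k -> odd (num_gray (swapped k s)).
Proof. by case/swapped_geom=> l [Ul _ Dl]; apply/odd_num_grayP; exists l. Qed.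

Lemma up_add_swapped s : 2 <= s -> (up k s + swapped k s)%MM = mu k s.
Proof.
move=> s2; apply/mnmP=> i; rewrite mnmDE !mnmE /ends /=.
case: eqP => [->|i0] /=; first by rewrite ifT //; lia.
case: eqP => [->|iB] /=; first by rewrite ifT ?addn1 //; lia.
by case: ifP => // _; rewrite expnS; lia.
Qed.

Lemma mdeg_up s : s <= k -> mdeg (up k s) = (2 ^ s).-1.
Proof.
move=> sk; rewrite up_geom // mdeg_geom ?take_uniq ?enum_uniq //.
by rewrite size_takel // size_enum_ord.
Qed.

Lemma mdeg_swapped s : 2 <= s <= k -> mdeg (swapped k s) = (2 ^ s).-1.
Proof. by case/swapped_geom=> l [Ul <- ->]; apply: mdeg_geom. Qed.

Lemma up_neq_swapped s : 2 <= s <= k -> up k s != swapped k s.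
Proof.
case/andP=> s2 sk; have k0 : 0 < k by lia.
apply/eqP=> /(congr1 (fun c : 'X_{1..k} => c (Ordinal k0))).
rewrite !mnmE /= ifT; last by lia.
by move/eqP; rewrite eqn_exp2l // => /eqP; lia.
Qed.

Lemma count_geom_pairs s (L : seq 'X_{1..k}) : 2 <= s <= k -> uniq L ->
    {in L, forall c, odd (num_gray c)} -> up k s \in L -> swapped k s \in L ->
  count (fun p => p.1 + p.2 == mu k s)%MM [seq (c1, c2) | c1 <- L, c2 <- L] = 2.
Proof.
move=> s2k UL oddL upL swL; rewrite -size_filter.
rewrite -[2]/(size [:: (up k s, swapped k s); (swapped k s, up k s)]).
apply: perm_size; apply: uniq_perm.
- by rewrite filter_uniq // allpairs_uniq // => -[? ?] [? ?] _ _ /= [-> ->].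
- by rewrite /= inE xpair_eqE (negPf (up_neq_swapped s2k)).
have s2 : 2 <= s by case/andP: s2k.
case=> c1 c2; rewrite mem_filter !inE !xpair_eqE /=; apply/andP/orP.
  case=> /eqP Dmu /allpairsP[[x y] /= [xL yL [e1 e2]]]; subst x y.
  case: (geom_pair_unique s2k (oddL _ xL) (oddL _ yL) Dmu) => -[-> ->].
    by left; rewrite !eqxx.
  by right; rewrite !eqxx.
case=> /andP[/eqP-> /eqP->]; split.
- by rewrite up_add_swapped.
- by apply/allpairsP; exists (up k s, swapped k s).
- by rewrite addmC up_add_swapped.
- by apply/allpairsP; exists (swapped k s, up k s).
Qed.

Lemma mem_odd_part (M : seq 'X_{1..k}) c : (c \in odd_part M) = odd (count_mem c M).
Proof.
rewrite mem_filter mem_undup andb_idr // -has_pred1 has_count.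
by case: (count _ M).
Qed.

Lemma odd_part_uniq (M : seq 'X_{1..k}) : uniq (odd_part M).
Proof. by rewrite filter_uniq // undup_uniq. Qed.

(** The coefficient counts the ways to write [mu s] as an ordered sum of two contents
of odd multiplicity in the list; [up s] and [swapped s] give the only two. *)
Lemma count_sqr_mod4 (T : eqType) (f : T -> 'X_{1..k}) (U : seq T) s n :
    2 <= s <= k ->
    {in odd_part [seq f u | u <- U], forall c, odd (num_gray c)} ->
    up k s \in odd_part [seq f u | u <- U] ->
    swapped k s \in odd_part [seq f u | u <- U] ->
  (((\sum_(u <- U) 'X_[f u]) ^+ (2 ^ n.+1) : {mpoly 'Z_4[k]})@_(mu k s *+ 2 ^ n)%MM = 2%:R :> 'Z_4)%R.
Proof.
move=> s2k oddM upM swM.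
rewrite -(big_map f xpredT (fun m => 'X_[m])) (sumX_exp2n Z4_natr4).
by rewrite sumX_sqr_coef ?expn_gt0 // count_geom_pairs // odd_part_uniq.
Qed.

(** A gray word with a single occurrence of [L] is [u ++ L :: v], where [u] and [v]
are gray and free of [L]; thus the count is the coefficient of [mu s] in the square
of the generating polynomial of gray words without [L]. *)
Lemma num_gray_mu_add1 s (L : 'I_k) : 2 <= s -> L = s :> nat ->
  num_gray (mu k s + U_(L))%MM = 2 %[mod 4].
Proof.
move=> s2 Ls; have s2k : 2 <= s <= k by rewrite s2 -Ls ltnW.
(* U lists the gray words avoiding L that are short enough to matter. *)
pose W := [pred t : (mdeg (mu k s)).-bseq 'I_k | gray t && (L \notin val t)].
pose U := [seq val t | t <- enum W].
have UU : uniq U by rewrite map_inj_uniq ?enum_uniq //; apply: val_inj.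
have memU w : (w \in U) = [&& size w <= mdeg (mu k s), gray w & L \notin w].
  apply/mapP/idP => [[t]|/and3P[sw gw Lw]].
    by rewrite mem_enum inE => /andP[gt Lt] ->; rewrite gt Lt size_bseq.
  by exists (Bseq sw) => //; rewrite mem_enum inE /= gw.
have notL w : (L \notin w) = (content w L == 0).
  by rewrite contentE -has_pred1 has_count -eqn0Ngt.
have cU c : count_mem c [seq content u | u <- U] =
    if (mdeg c <= mdeg (mu k s)) && (c L == 0) then num_gray c else 0.
  rewrite count_map -size_filter; case: ifP => [/andP[dc cL]|h].
    apply: perm_size; apply: uniq_perm => [||w]; first exact: filter_uniq.
      exact: gray_words_uniq.
    rewrite mem_filter mem_gray_words memU /= notL -mdeg_content.
    by case: eqP => [->|_]; rewrite ?dc ?cL ?andbT ?andbF.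
  apply/eqP; rewrite size_eq0 -(negbK (_ == _)) -has_filter; apply/hasPn=> w.
  rewrite memU notL -mdeg_content => /and3P[sw _ wL] /=.
  by apply: contraFneq h => <-; rewrite sw.
have muL : mu k s L = 0.
  by rewrite mnmE /ends Ls ltnn ifF //; apply/negbTE; rewrite negb_or; apply/andP; split; apply/eqP; lia.
have Dmu := up_add_swapped s2.
have zL : up k s L = 0 /\ swapped k s L = 0.
  by have := congr1 (fun c : 'X_{1..k} => c L) Dmu; rewrite mnmDE muL; lia.
have dU : mdeg (up k s) <= mdeg (mu k s) /\ mdeg (swapped k s) <= mdeg (mu k s).
  by rewrite -Dmu mdegD; lia.
have e : (((\sum_(u <- U) 'X_[content u]) ^+ (2 ^ 1) : {mpoly 'Z_4[k]})@_(mu k s *+ 2 ^ 0)%MM = 2%:R :> 'Z_4)%R.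
  case: zL dU => [z1 z2] [d1 d2]; apply: count_sqr_mod4 => // [c||].
  - by rewrite mem_odd_part cU; case: ifP.
  - by rewrite mem_odd_part cU d1 z1 odd_num_gray_up //; case/andP: s2k.
  - by rewrite mem_odd_part cU d2 z2 odd_num_gray_swapped.
apply: Z4_natr_inj; rewrite -e -(big_map (@content k) xpredT (fun m => 'X_[m])%R).
have := @sumX_sqr_coef k 'Z_4 [seq content u | u <- U] 1 (mu k s) isT.
move=> h; rewrite [RHS]h; congr (_%:R)%R.
rewrite allpairs_mapl allpairs_mapr.
rewrite -[[seq (content x, content y) | x <- U, y <- U]](map_allpairs (fun p => (content p.1, content p.2)) pair).
(* The pair (u, v) of words of U corresponds to the word u ++ L :: v. *)
rewrite count_map -size_filter -(size_map (fun p => p.1 ++ L :: p.2)).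
symmetry; apply: perm_size; apply: uniq_perm; last first.
- move=> w; rewrite mem_gray_words; apply/mapP/idP => [[[u v]]|].
    rewrite mem_filter /= => /andP[/eqP uv /allpairsP[[u' v'] /= [uU vU [e1 e2]]] ->].
    subst u' v'; move: uU vU; rewrite !memU => /and3P[_ gu Lu] /and3P[_ gv Lv].
    by rewrite gray_cat_cons //= content_cat content_cons -uv; apply/eqP/mnmP=> i; rewrite !mnmDE; lia.
  case/andP=> gw /eqP cw.
  have cwL : count_mem L w = 1 by rewrite -contentE cw mnmDE muL mnm1E eqxx.
  have Lw : L \in w by rewrite -has_pred1 has_count cwL.
  case/splitPr: Lw gw cw cwL => u v gw cw.
  rewrite count_cat /= eqxx add1n addnS => -[] /eqP; rewrite addn_eq0 => /andP[cu cv].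
  have Lu : L \notin u by rewrite -has_pred1 has_count -eqn0Ngt.
  have Lv : L \notin v by rewrite -has_pred1 has_count -eqn0Ngt.
  have uv : (content u + content v)%MM = mu k s.
    apply/mnmP=> i; have := congr1 (fun c : 'X_{1..k} => c i) cw.
    by rewrite content_cat content_cons !mnmDE; lia.
  exists (u, v) => //; rewrite mem_filter /= uv eqxx /=.
  apply/allpairsP; exists (u, v); rewrite !memU Lu Lv -!mdeg_content -uv mdegD.
  rewrite leq_addr leq_addl (@gray_infix _ [::] u (L :: v)) //.
  by rewrite (@gray_infix _ (u ++ [:: L]) v [::]) // cats0 -catA.
- exact: gray_words_uniq.
rewrite map_inj_in_uniq ?filter_uniq ?allpairs_uniq // => [[? ?] [? ?] _ _ /= [-> ->] //|].
have first_part p : p \in [seq (x, y) | x <- U, y <- U] -> L \notin p.1.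
  by case/allpairsP=> -[x y] /= [+ _ ->]; rewrite memU => /and3P[].
case=> [u v] [u' v']; rewrite !mem_filter.
case/andP=> _ /first_part /= Lu; case/andP=> _ /first_part /= Lu' ee.
have szu : size u = size u'.
  by have := congr1 (index L) ee; rewrite !index_cat (negPf Lu) (negPf Lu') /= eqxx !addn0.
by move/eqP: ee; rewrite (eqseq_cat _ _ szu) => /andP[/eqP-> /eqP[->]].
Qed.

End Pairs.

(** * Gray codes and their words *)

(** Counting classes by representatives, one element [h y] for each [y] in [Y]. *)
Lemma card_equivalence_partition (T T' : finType) (R : rel T) (D : {set T})
    (Y : {set T'}) (h : T' -> T) :
    reflexive R -> ssrbool.symmetric R -> transitive R ->
    {in Y, forall y, h y \in D} -> {in D, forall x, exists2 y, y \in Y & R x (h y)} ->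
    {in Y &, forall y y', R (h y) (h y') -> y = y'} ->
  #|equivalence_partition R D| = #|Y|.
Proof.
move=> Rxx Rsym Rtr hD hR hI.
pose g y := [set x in D | R (h y) x].
rewrite -(card_in_imset (f := g) (D := Y)).
  congr #|pred_of_set _|; apply/setP=> B; apply/imsetP/imsetP => [[x xD ->]|[y yY ->]].
    have [y yY Rxy] := hR x xD; exists y => //; apply/setP=> z; rewrite !inE.
    case: (z \in D) => //=; apply/idP/idP; last exact: Rtr.
    by apply: Rtr; rewrite Rsym.
  by exists (h y); first exact: hD.
move=> y y' yY y'Y /setP/(_ (h y')); rewrite !inE hD // Rxx /=.
exact: hI.
Qed.

Section GrayCodes.
Variable k : nat.
Notation gword := ((2 ^ k).-1.-tuple 'I_k).
Implicit Types (t : gword) (G : 'M[bool]_(k, 2 ^ k)) (i : 'I_k).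

Lemma pred_exp2K : (2 ^ k).-1.+1 = 2 ^ k.
Proof. by rewrite prednK // expn_gt0. Qed.

(** Two prefixes with the same parities differ by an even infix. *)
Lemma gray_prefix_inj (w : seq 'I_k) a b :
    gray w -> a <= size w -> b <= size w ->
    (forall i, odd (count_mem i (take a w)) = odd (count_mem i (take b w))) ->
  a = b.
Proof.
wlog le_ab : a b / a <= b => [hw gw aw bw e|gw aw bw e].
  by case/orP: (leq_total a b) => le; [|symmetry]; apply: hw => // i; rewrite e.
have Dw : w = take a w ++ take (b - a) (drop a w) ++ drop b w.
  by rewrite -{2}(subnK le_ab) -drop_drop !cat_take_drop.
have Db : take b w = take a w ++ take (b - a) (drop a w).
  by rewrite -{1}(subnKC le_ab) takeD.
have : take (b - a) (drop a w) = [::].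
  apply: (grayP _ gw _ _ _ Dw); apply/evenwP=> i; have := e i.
  by rewrite Db count_cat oddD; case: odd; case: odd.
by move/(congr1 size); rewrite size_takel ?size_drop /=; lia.
Qed.

(** A gray word of length [2 ^ k - 1] visits [2 ^ k] distinct vertices, hence all of
them. *)
Lemma gray_onto t (v : 'I_k -> bool) : gray t ->
  exists b : 'I_(2 ^ k), forall i, v i = odd (count_mem i (take b t)).
Proof.
move=> gt; pose f (b : 'I_(2 ^ k)) : {ffun 'I_k -> bool} := [ffun i => odd (count_mem i (take b t))].
have fI : injective f.
  have sz (x : 'I_(2 ^ k)) : x <= size t by rewrite size_tuple -ltnS pred_exp2K.
  move=> b b' /ffunP e; apply/val_inj/(gray_prefix_inj gt (sz b) (sz b')) => i.
  by have := e i; rewrite !ffunE.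
have /codomP[b Db] : [ffun i => v i] \in codom f.
  by apply: inj_card_onto => //; rewrite card_ffun card_bool !card_ord.
by exists b => i; have /ffunP/(_ i) := Db; rewrite !ffunE.
Qed.

Lemma gray_mem t i : gray t -> i \in t.
Proof.
move=> gt; have [b /(_ i)] := gray_onto (fun i' => i' == i) gt.
rewrite eqxx => /esym oc; apply: (@mem_take b).
by rewrite -has_pred1 has_count; case: count oc.
Qed.

(** [t] is the word of transitions along the columns of [G]. *)
Definition traces t (G : 'M[bool]_(k, 2 ^ k)) :=
  forall i (b : 'I_(2 ^ k)), G i b = G i (first_idx k) (+) odd (count_mem i (take b t)).

Lemma step_subproof (m m' : 'I_(2 ^ k)) : m' = m.+1 :> nat -> m < (2 ^ k).-1.
Proof. by move=> e; rewrite -ltnS pred_exp2K -e ltn_ord. Qed.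

Lemma take_step t (m m' : 'I_(2 ^ k)) (e : m' = m.+1 :> nat) :
  take m' t = rcons (take m t) (tnth t (Ordinal (step_subproof e))).
Proof.
have lt := step_subproof e.
rewrite e (take_nth (tnth t (Ordinal lt))) ?size_tuple //; congr (rcons _ _).
by rewrite [RHS](tnth_nth (tnth t (Ordinal lt))).
Qed.

Lemma traces_step t G (m m' : 'I_(2 ^ k)) (e : m' = m.+1 :> nat) i : traces t G ->
  (G i m != G i m') = (tnth t (Ordinal (step_subproof e)) == i).
Proof.
move=> tG; rewrite !(tG i m) !(tG i m') (take_step _ e) -cats1 count_cat oddD /= addn0 oddb.
by case: (tnth _ _ == i); case: (G i _); case: (odd _).
Qed.

Lemma gray_codeP G : reflect (exists2 t : gword, gray t & traces t G) (gray_code G).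
Proof.
apply: (iffP andP) => [[/forallP onto /forallP adj]|[t gt tG]].
  have letter (b : 'I_(2 ^ k).-1) : exists l : 'I_k, forall m m' : 'I_(2 ^ k),
      m = b :> nat -> m' = b.+1 :> nat -> forall i, (G i m != G i m') = (i == l).
    have lt1 : b.+1 < 2 ^ k by rewrite -ltn_predRL.
    have lt0 : b < 2 ^ k by apply: ltn_trans lt1.
    have /forallP/(_ (Ordinal lt1)) := adj (Ordinal lt0); rewrite /= eqxx /=.
    case/cards1P=> l El; exists l => m m' Em Em' i.
    have -> : m = Ordinal lt0 by apply/val_inj.
    have -> : m' = Ordinal lt1 by apply/val_inj.
    by have /setP/(_ i) := El; rewrite !inE.
  have [l hl] := fin_all_exists letter.
  pose t := [tuple l b | b < (2 ^ k).-1].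
  have tG : traces t G.
    move=> i [b lt_b]; elim: b lt_b => [|b IHb] lt_b /=.
      by rewrite take0 addbF; congr (G i _); apply/val_inj.
    have lt_b' : b < 2 ^ k by apply: ltn_trans lt_b.
    pose m := Ordinal lt_b'; pose m' := Ordinal lt_b.
    have e : m' = m.+1 :> nat by [].
    have := hl (Ordinal (step_subproof e)) m m' erefl erefl i.
    have -> : take b.+1 t = rcons (take b t) (l (Ordinal (step_subproof e))).
      exact: etrans (take_step t e) (congr1 (rcons _) (tnth_mktuple l _)).
    rewrite -cats1 count_cat oddD /= addn0 oddb addbA -(IHb lt_b') [l _ == i]eq_sym => <-.
    by rewrite -/m -/m'; case: (G i m); case: (G i m').
  exists t => //; apply/grayP=> a b d Dt eb.
  have st : size (a ++ b) <= (2 ^ k).-1.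
    by rewrite -(size_tuple t) Dt catA [leqRHS]size_cat leq_addr.
  have lt2 : size a + size b < 2 ^ k by rewrite -size_cat -pred_exp2K ltnS.
  have lt1 : size a < 2 ^ k by apply: leq_ltn_trans lt2; rewrite leq_addr.
  pose m := Ordinal lt1; pose m' := Ordinal lt2.
  have colI : injective (fun m => col m G).
    have /image_injP colI : #|image (fun m => col m G) 'I_(2 ^ k)| == #|'I_(2 ^ k)|.
      rewrite (eq_card (B := predT)) => [|v].
        by rewrite card_mx card_bool muln1 card_ord.
      have /existsP[x /eqP <-] := onto v; rewrite [RHS]inE /=.
        by apply/imageP; exists x.
    by move=> x y; apply: colI.
  have Em : m' = m.
    apply: colI; apply/matrixP=> i z; rewrite !mxE (tG i m) (tG i m') /= Dt catA.
    rewrite -size_cat take_size_cat // -catA take_size_cat // count_cat oddD.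
    by rewrite (evenwP _ eb) addbF.
  by apply/nilP; rewrite /nilp; have := congr1 val Em => /=; lia.
split.
  apply/forallP=> v; apply/existsP.
  have [b hb] := gray_onto (fun i => v i 0%R (+) G i (first_idx k)) gt.
  exists b; apply/eqP/matrixP=> i z; rewrite !mxE tG -hb ord1.
  by case: (G i _); case: (v i _).
apply/forallP=> m; apply/forallP=> m'; apply/implyP=> /eqP e; apply/cards1P.
exists (tnth t (Ordinal (step_subproof e))); apply/setP=> i.
by rewrite !inE (traces_step e _ tG) eq_sym.
Qed.

Lemma traces_transition_count t G i : traces t G -> transition_count G i = count_mem i t.
Proof.
move=> tG; rewrite /transition_count.
have le : (2 ^ k).-1 <= 2 ^ k by rewrite leq_pred.
have -> : [set m : 'I_(2 ^ k) |
       [exists m' : 'I_(2 ^ k), (m' == m.+1 :> nat) && (G i m != G i m')]] =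
    widen_ord le @: [set b | tnth t b == i].
  apply/setP=> m; rewrite inE; apply/existsP/imsetP => [[m' /andP[/eqP e]]|[b]].
    rewrite (traces_step e _ tG) => ti.
    by exists (Ordinal (step_subproof e)); rewrite ?inE //; apply/val_inj.
  rewrite inE => ti ->.
  have lt : b.+1 < 2 ^ k by rewrite -ltn_predRL.
  exists (Ordinal lt); rewrite /= eqxx /=.
  have e : Ordinal lt = (widen_ord le b).+1 :> nat by [].
  by rewrite (traces_step e _ tG) (_ : Ordinal _ = b) //; apply/val_inj.
rewrite card_imset => [|x y /(congr1 val) /= /val_inj //].
by rewrite cardsE -sum1_card -sum1_count big_tuple.
Qed.

Lemma traces_inj t t' G : traces t G -> traces t' G -> t = t'.
Proof.
move=> tG t'G; apply: eq_from_tnth => b.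
have lt1 : b.+1 < 2 ^ k by rewrite -ltn_predRL.
have lt0 : b < 2 ^ k by apply: ltn_trans lt1.
have e : Ordinal lt1 = (Ordinal lt0).+1 :> nat by [].
have := traces_step e (tnth t b) tG; rewrite (traces_step e _ t'G).
rewrite (_ : Ordinal (step_subproof e) = b); last by apply/val_inj.
by rewrite eqxx => /eqP.
Qed.

End GrayCodes.

(** * Isomorphism and equivalence classes as families of words *)

Section Classes.
Variables (j k : nat).
Hypothesis j_gt0 : 0 < j.
Notation gword := ((2 ^ k).-1.-tuple 'I_k).
Notation words := {ffun 'I_j -> gword}.
Notation matrices := 'M[bool]_(k, j * 2 ^ k).
Implicit Types (t : gword) (W : words) (A : matrices) (e : {ffun 'I_k -> bool}) (s : 'S_k).

Let a0 : 'I_j := Ordinal j_gt0.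

Lemma block_of_proof (q : 'I_(j * 2 ^ k)) : q %/ 2 ^ k < j.
Proof. by rewrite ltn_divLR ?expn_gt0. Qed.

(** The index of the block that contains the column [q]. *)
Definition block_of (q : 'I_(j * 2 ^ k)) : 'I_j := Ordinal (block_of_proof q).

(** The matrix with zero first column whose blocks have the transition words [W]. *)
Definition matrix_of W : matrices := \matrix_(i < k, q < j * 2 ^ k)
  odd (\sum_(x < j | x < q %/ 2 ^ k) count_mem i (W x)
       + count_mem i (take (q %% 2 ^ k) (W (block_of q)))).

Lemma block_matrix_ofE W a i (b : 'I_(2 ^ k)) :
  block (matrix_of W) a i b =
    odd (\sum_(x < j | x < a) count_mem i (W x) + count_mem i (take b (W a))).
Proof.
rewrite !mxE /= divnMDl ?expn_gt0 // divn_small // addn0 modnMDl modn_small //.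
by congr (odd (_ + count_mem i (take b (W _)))); apply/val_inj;
   rewrite /= divnMDl ?expn_gt0 // divn_small // addn0.
Qed.

Lemma block_inj A B : (forall a : 'I_j, block A a = block B a) -> A = B.
Proof.
move=> h; apply/matrixP=> i q.
have lt : q %% 2 ^ k < 2 ^ k by rewrite ltn_mod expn_gt0.
have /matrixP/(_ i (Ordinal lt)) := h (block_of q); rewrite !mxE.
rewrite (_ : Ordinal _ = q) //; apply/val_inj => /=.
by rewrite -divn_eq.
Qed.

Lemma block_flip e A (a : 'I_j) : block (flip_rows e A) a = flip_rows e (block A a).
Proof. by apply/matrixP=> i b; rewrite !mxE. Qed.

Lemma traces_flip_matrix_of W e a : traces (W a) (block (flip_rows e (matrix_of W)) a).
Proof.
move=> i b; rewrite block_flip mxE [in RHS]mxE !block_matrix_ofE /= take0 addn0.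
by rewrite oddD addbA.
Qed.

Lemma flip_matrix_of_inj W W' e : matrix_of W' = flip_rows e (matrix_of W) -> W' = W.
Proof.
move=> eM; apply/ffunP=> a; apply: (traces_inj (G := block (matrix_of W') a)).
  have := @traces_flip_matrix_of W' [ffun=> false] a.
  by congr traces; congr block; apply/matrixP=> i q; rewrite mxE ffunE.
by rewrite eM; apply: traces_flip_matrix_of.
Qed.

(** All the words of the family are gray. *)
Definition gray_family W := [forall a, gray (W a)].

(** The row inversion [e] is the first column of the matrix. *)
Lemma equipartingP (c : {ffun 'I_k -> int}) A :
  equiparting c A <->
    exists W e, [/\ gray_family W,
       forall i, c i = Posz (\sum_(a < j) count_mem i (W a)) & A = flip_rows e (matrix_of W)].
Proof.
split=> [/and3P[/forallP gA /forallP link /forallP cA] | [W [e [/forallP gW cW ->]]]].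
  have gA' a : exists t : gword, gray t /\ traces t (block A a).
    by have /gray_codeP[t] := gA a; exists t.
  have [W hW] := fin_all_exists gA'.
  pose e : {ffun 'I_k -> bool} := [ffun i => block A a0 i (first_idx k)].
  exists (finfun W), e; split.
  - by apply/forallP=> a; rewrite ffunE; case: (hW a).
  - move=> i; have /eqP <- := cA i; congr Posz; apply: eq_bigr => a _.
    by rewrite ffunE; apply: traces_transition_count; case: (hW a).
  have start a i : block A a i (first_idx k) =
      e i (+) odd (\sum_(x < j | x < a) count_mem i (W x)).
    case: a => a lt_a; elim: a lt_a => [|a IHa] lt_a.
      rewrite big_pred0 ?addbF; last by move=> x; rewrite ltn0.
      by rewrite ffunE; congr (block A _ i _); apply/val_inj.
    have lt_a' : a < j by apply: ltn_trans lt_a.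
    have /forallP/(_ (Ordinal lt_a)) := link (Ordinal lt_a'); rewrite /= eqxx /=.
    move/eqP/matrixP/(_ i 0%R); rewrite mxE [in RHS]mxE => <-.
    have [_ tr] := hW (Ordinal lt_a'); rewrite tr IHa /= subn1 take_oversize ?size_tuple //.
    rewrite [in RHS](bigD1 (Ordinal lt_a')) //= oddD addbA addbAC; congr (_ (+) _ (+) _).
    by congr odd; apply: eq_bigl => x; rewrite ltn_neqAle andbC.
  apply: block_inj => a; rewrite block_flip; apply/matrixP=> i b.
  have FW x : finfun W x = W x by rewrite ffunE.
  have [_ tr] := hW a; rewrite tr start [RHS]mxE block_matrix_ofE FW oddD addbA.
  by under [in RHS]eq_bigr => x _ do rewrite FW.
have tr := traces_flip_matrix_of W e.
apply/and3P; split.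
- by apply/forallP=> a; apply/gray_codeP; exists (W a).
- apply/forallP=> a; apply/forallP=> b; apply/implyP=> /eqP Db.
  apply/eqP/matrixP=> i z; rewrite !block_flip [LHS]mxE [RHS]mxE [LHS]mxE [RHS]mxE !block_matrix_ofE.
  rewrite /= take0 addn0 subn1 take_oversize ?size_tuple //; congr (_ (+) odd _).
  rewrite [RHS](bigD1 a) /= ?Db // addnC; congr (_ + _); apply: eq_bigl => x.
  by rewrite ltn_neqAle andbC.
- apply/forallP=> i; rewrite cW; apply/eqP; congr Posz; apply: eq_bigr => a _.
  by rewrite (traces_transition_count _ (tr a)).
Qed.

Lemma flip_flip (n : nat) e e' (A : 'M[bool]_(k, n)) :
  flip_rows e (flip_rows e' A) = flip_rows [ffun i => e i (+) e' i] A.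
Proof. by apply/matrixP=> i q; rewrite !mxE ffunE addbA. Qed.

Lemma flip0 (n : nat) (A : 'M[bool]_(k, n)) : flip_rows [ffun=> false] A = A.
Proof. by apply/matrixP=> i q; rewrite mxE ffunE. Qed.

Lemma flipK (n : nat) e (A : 'M[bool]_(k, n)) : flip_rows e (flip_rows e A) = A.
Proof. by apply/matrixP=> i q; rewrite !mxE addbA addbb. Qed.

Lemma isomorphic_refl n : reflexive (@isomorphic k n).
Proof. by move=> A; apply/existsP; exists [ffun=> false]; rewrite flip0. Qed.

Lemma isomorphic_sym n : ssrbool.symmetric (@isomorphic k n).
Proof.
by move=> A B; apply/existsP/existsP => -[e /eqP ->]; exists e; rewrite flipK.
Qed.

Lemma isomorphic_trans n : transitive (@isomorphic k n).
Proof.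
move=> B A C /existsP[e /eqP ->] /existsP[e' /eqP ->]; apply/existsP.
by eexists; rewrite flip_flip.
Qed.

Section Equivalence.
Variable c : {ffun 'I_k -> int}.

Lemma stabilizes1 : stabilizes c 1%g.
Proof. by apply/forallP=> i; rewrite perm1. Qed.

Lemma stabilizesM s s' : stabilizes c s -> stabilizes c s' -> stabilizes c (s * s')%g.
Proof.
move=> /forallP h /forallP h'; apply/forallP=> i.
by rewrite permM (eqP (h' _)) (eqP (h _)).
Qed.

Lemma stabilizesV s : stabilizes c s -> stabilizes c s^-1%g.
Proof.
by move=> /forallP h; apply/forallP=> i; have := h (s^-1%g i); rewrite permKV eq_sym.
Qed.

Lemma row_perm_flip n s e (A : 'M[bool]_(k, n)) :
  row_perm s (flip_rows e A) = flip_rows [ffun i => e (s i)] (row_perm s A).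
Proof. by apply/matrixP=> i q; rewrite !mxE ffunE. Qed.

Lemma equivalentP n (A B : 'M[bool]_(k, n)) :
  reflect (exists e s, stabilizes c s /\ B = flip_rows e (row_perm s A)) (equivalent c A B).
Proof.
apply: (iffP existsP) => [[e /existsP[s /andP[cs /eqP DB]]]|[e [s [cs DB]]]].
  by exists e, s.
by exists e; apply/existsP; exists s; rewrite cs DB eqxx.
Qed.

Lemma equivalent_refl n : reflexive (@equivalent k n c).
Proof.
move=> A; apply/equivalentP; exists [ffun=> false], 1%g; rewrite stabilizes1 flip0.
by rewrite row_perm1.
Qed.

Lemma equivalent_sym_imp n (A B : 'M[bool]_(k, n)) : equivalent c A B -> equivalent c B A.
Proof.
move=> /equivalentP[e [s [cs ->]]]; apply/equivalentP.
exists [ffun i => e (s^-1%g i)], s^-1%g; split; first exact: stabilizesV.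
by rewrite row_perm_flip -row_permM mulVg row_perm1 flipK.
Qed.

Lemma equivalent_sym n : ssrbool.symmetric (@equivalent k n c).
Proof. by move=> A B; apply/idP/idP; apply: equivalent_sym_imp. Qed.

Lemma equivalent_trans n : transitive (@equivalent k n c).
Proof.
move=> B A C /equivalentP[e [s [cs ->]]] /equivalentP[e' [s' [cs' ->]]].
apply/equivalentP; rewrite row_perm_flip -row_permM flip_flip.
by do 2!eexists; split; last reflexivity; apply: stabilizesM.
Qed.

End Equivalence.

(** The action of a permutation of the rows on families of words. *)
Definition relabel s W : words := [ffun a => map_tuple s (W a)].

Lemma row_perm_matrix_of s W : row_perm s (matrix_of (relabel s W)) = matrix_of W.
Proof.
apply/matrixP=> i q; rewrite !mxE.
have cm (w : seq 'I_k) : count_mem (s i) (map s w) = count_mem i w.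
  by rewrite count_map; apply: eq_count => x /=; rewrite (inj_eq perm_inj).
under eq_bigr => x _ do rewrite ffunE /= cm.
by rewrite ffunE /= -map_take cm.
Qed.

Lemma relabelM s s' W : relabel s' (relabel s W) = relabel (s * s')%g W.
Proof.
apply/ffunP=> a; rewrite !ffunE; apply/val_inj => /=.
by rewrite -map_comp; apply: eq_map => x /=; rewrite permM.
Qed.

Lemma relabel1 W : relabel 1%g W = W.
Proof.
apply/ffunP=> a; rewrite ffunE; apply/val_inj => /=.
by rewrite (eq_map (perm1 (T := _))) map_id.
Qed.

(** The families of gray words with total content [m]. *)
Definition word_families (m : 'X_{1..k}) : {set words} :=
  [set W | gray_family W & (\sum_(a < j) content (W a))%MM == m].

(** An exponent vector as an integer vector. *)
Definition int_content (m : 'X_{1..k}) : {ffun 'I_k -> int} := [ffun i => Posz (m i)].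

Lemma equiparting_setP m A :
  A \in equiparting_set j (int_content m) <->
    exists W e, W \in word_families m /\ A = flip_rows e (matrix_of W).
Proof.
rewrite inE equipartingP; split=> -[W [e]].
  case=> gW cW DA; exists W, e; split=> //; rewrite inE gW; apply/eqP/mnmP=> i.
  by have [] := cW i; rewrite ffunE => -[->]; rewrite mnm_sumE; apply: eq_bigr => a _; rewrite contentE.
rewrite inE => -[/andP[gW /eqP cW] DA]; exists W, e; split=> // i.
by rewrite ffunE -cW mnm_sumE; congr Posz; apply: eq_bigr => a _; rewrite contentE.
Qed.

Lemma num_noniso_eq m : num_noniso j (int_content m) = #|word_families m|.
Proof.
apply: (card_equivalence_partition (h := matrix_of)).
- exact: isomorphic_refl.
- exact: isomorphic_sym.
- exact: isomorphic_trans.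
- move=> W WY; apply/equiparting_setP; exists W, [ffun=> false]; split=> //.
  by rewrite flip0.
- move=> A /equiparting_setP[W [e [WY ->]]]; exists W => //.
  by apply/existsP; exists e; rewrite flipK.
- by move=> W W' _ _ /existsP[e /eqP /flip_matrix_of_inj].
Qed.

Section Transversal.
Variable c : {ffun 'I_k -> int}.

(** Two words in one orbit of the stabilizer of [c]. *)
Definition related t t' := [exists s, stabilizes c s && (t' == map_tuple s t)].

(** A word chosen in the orbit of [t]; the choice depends on the orbit only. *)
Definition representative t : gword := odflt t [pick u | related t u].

(** The chosen representatives, one in each orbit of the stabilizer. *)
Definition canonical : {set gword} := [set t | representative t == t].

Lemma relatedP t t' :
  reflect (exists2 s, stabilizes c s & t' = map_tuple s t) (related t t').
Proof.
by apply: (iffP existsP) => [[s /andP[cs /eqP]]|[s cs ->]]; exists s; rewrite ?cs ?eqxx.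
Qed.

Lemma map_tupleM s s' t : map_tuple s' (map_tuple s t) = map_tuple (s * s')%g t.
Proof.
apply/val_inj; rewrite /= -map_comp.
by apply: eq_map => x /=; rewrite permM.
Qed.

Lemma map_tuple1 t : map_tuple (1%g : 'S_k) t = t.
Proof. by apply/val_inj; rewrite /= (eq_map (perm1 (T := _))) map_id. Qed.

Lemma related_representative t : related t (representative t).
Proof.
rewrite /representative; case: pickP => //= _; apply/relatedP; exists 1%g.
  exact: stabilizes1.
by rewrite map_tuple1.
Qed.

Lemma eq_representative t t' : related t t' -> representative t = representative t'.
Proof.
move/relatedP=> [s cs Dt'].
have E : related t =1 related t'.
  move=> u; apply/relatedP/relatedP => -[s' cs' ->].
    exists (s^-1 * s')%g; first by apply: stabilizesM => //; apply: stabilizesV.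
    by rewrite Dt' map_tupleM mulKVg.
  by exists (s * s')%g; [exact: stabilizesM | rewrite Dt' map_tupleM].
rewrite /representative -(eq_pick E); case: pickP => //= h.
have := h t'; rewrite (_ : related t t' = true) //.
by apply/relatedP; exists s.
Qed.

(** A permutation fixing a full gray word fixes each of its letters, that is, every
letter. *)
Lemma map_tuple_free s t : gray t -> map_tuple s t = t -> s = 1%g.
Proof.
move=> gt /(congr1 val) /= e; apply/permP=> i; rewrite perm1.
have it := gray_mem i gt.
have := congr1 (fun w => nth i w (index i t)) e.
by rewrite (nth_map i) ?index_mem // nth_index.
Qed.

End Transversal.

(** The families of total content [m] whose first word is canonical: since the
stabilizer acts freely on the first word, each of its orbits on families contains
exactly one of them. *)
Definition canonical_set (m : 'X_{1..k}) : {set words} :=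
  [set W in word_families m | W a0 \in canonical (int_content m)].

Lemma relabel_word_families s W m : stabilizes (int_content m) s ->
  (relabel s W \in word_families m) = (W \in word_families m).
Proof.
have imp s' W' : stabilizes (int_content m) s' -> W' \in word_families m -> relabel s' W' \in word_families m.
  move=> /forallP cs; rewrite !inE => /andP[/forallP gW /eqP cW]; apply/andP; split.
    by apply/forallP=> a; rewrite ffunE /= gray_map //; apply: perm_inj.
  apply/eqP/mnmP=> i; rewrite mnm_sumE -[i](permKV s').
  have := cs (s'^-1%g i); rewrite !ffunE => /eqP [->].
  rewrite -cW mnm_sumE; apply: eq_bigr => a _; rewrite ffunE !contentE /= count_map.
  by apply: eq_count => x /=; rewrite (inj_eq perm_inj).
move=> cs; apply/idP/idP; last exact: imp.
by move/(imp _ _ (stabilizesV cs)); rewrite relabelM mulgV relabel1.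
Qed.

Lemma num_nonequiv_eq m : num_nonequiv j (int_content m) = #|canonical_set m|.
Proof.
apply: (card_equivalence_partition (h := matrix_of)).
- exact: equivalent_refl.
- exact: equivalent_sym.
- exact: equivalent_trans.
- move=> W; rewrite inE => /andP[WY _]; apply/equiparting_setP.
  by exists W, [ffun=> false]; rewrite flip0.
- move=> A /equiparting_setP[W [e [WY ->]]].
  have /relatedP[s cs Ds] := related_representative (int_content m) (W a0).
  exists (relabel s W).
    rewrite inE relabel_word_families // WY /= ffunE -Ds inE; apply/eqP/esym.
    exact/eq_representative/related_representative.
  by rewrite equivalent_sym; apply/equivalentP; exists e, s; rewrite row_perm_matrix_of.
- move=> W W'; rewrite !inE => /andP[/andP[/forallP gW _] /eqP cW] /andP[_ /eqP cW'].
  case/equivalentP=> e [s [cs]].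
  have -> : W = relabel s (relabel s^-1%g W) by rewrite relabelM mulVg relabel1.
  rewrite row_perm_matrix_of => /flip_matrix_of_inj DW'; rewrite relabelM mulVg relabel1.
  have rel : related (int_content m) (W a0) (W' a0).
    by apply/relatedP; exists s^-1%g; rewrite ?DW' ?ffunE //; apply: stabilizesV.
  have E : W' a0 = W a0 by rewrite -cW -cW' (eq_representative rel).
  have s1 : s^-1%g = 1%g.
    by apply: (map_tuple_free (gW a0)); rewrite -[RHS]E DW' ffunE.
  by rewrite DW' s1 relabel1.
Qed.

Lemma num_noniso_stabilizer m :
  num_noniso j (int_content m) = #|[set s | stabilizes (int_content m) s]| * num_nonequiv j (int_content m).
Proof.
rewrite num_noniso_eq num_nonequiv_eq -cardsX.
rewrite -(card_in_imset (f := fun p => relabel p.1 p.2)); last first.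
  move=> [s W] [s' W'] /=; rewrite !inE /= => /andP[cs /andP[/andP[/forallP gW _] /eqP cW]].
  move=> /andP[cs' /andP[_ /eqP cW']] e.
  have DW' : W' = relabel (s * s'^-1)%g W by rewrite -relabelM e relabelM mulgV relabel1.
  have rel : related (int_content m) (W a0) (W' a0).
    apply/relatedP; exists (s * s'^-1)%g; last by rewrite DW' ffunE.
    by apply: stabilizesM => //; apply: stabilizesV.
  have E : W' a0 = W a0 by rewrite -cW -cW' (eq_representative rel).
  have s1 : (s * s'^-1)%g = 1%g.
    by apply: (map_tuple_free (gW a0)); rewrite -[RHS]E DW' ffunE.
  by rewrite DW' s1 relabel1; congr pair; apply/eqP; rewrite eq_mulgV1 s1.
congr #|pred_of_set _|; apply/setP=> W; apply/idP/imsetP.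
  move=> WY; have /relatedP[s cs Ds] := related_representative (int_content m) (W a0).
  exists (s^-1%g, relabel s W); last by rewrite /= relabelM mulgV relabel1.
  rewrite inE /= inE stabilizesV //= inE relabel_word_families // WY /= ffunE -Ds inE.
  exact/eqP/esym/eq_representative/related_representative.
case=> -[s W'] /=; rewrite inE /= inE => /andP[cs]; rewrite inE => /andP[WY _] ->.
by rewrite relabel_word_families.
Qed.

End Classes.

(** * Class numbers as coefficients, and the bounds *)

Section Counting.
Variables (j k : nat).
Hypothesis j_gt0 : 0 < j.
Notation gword := ((2 ^ k).-1.-tuple 'I_k).
Implicit Types (m : 'X_{1..k}).

(** Expanding a product of sums of monomials counts families by total content. *)
Lemma card_family_poly (R : comNzRingType) (F : 'I_j -> {set gword}) m :
  (#|[set W : {ffun 'I_j -> gword} | (W \in family F) && ((\sum_(a < j) content (W a))%MM == m)]|%:R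
   = (\prod_(a < j) \sum_(t in F a) 'X_[content t] : {mpoly R[k]})@_m)%R.
Proof.
rewrite bigA_distr_big_dep raddf_sum /= -sum1_card natr_sum.
under [LHS]eq_bigl => W do rewrite inE.
rewrite big_mkcondr; apply: eq_bigr => W _.
by rewrite mprodXE mcoeffX; case: eqP.
Qed.

Lemma word_families_poly (R : comNzRingType) m :
  (#|word_families j m|%:R = (gray_poly k R ^+ j)@_m)%R.
Proof.
pose F (a : 'I_j) := [set t : gword | gray t].
have -> : word_families j m = [set W : {ffun 'I_j -> gword} |
    (W \in family F) && ((\sum_(a < j) content (W a))%MM == m)].
  apply/setP=> W; rewrite !inE; congr (_ && _); apply: eq_forallb => a.
  by rewrite inE.
rewrite card_family_poly; congr (_@_m)%R.
rewrite /F prodr_const card_ord; congr (_ ^+ _)%R.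
by apply: eq_bigl => t; rewrite inE.
Qed.

(** The generating polynomial of the canonical gray words for the stabilizer of
[m]. *)
Definition canonical_poly (R : comNzRingType) m : {mpoly R[k]} :=
  (\sum_(t : gword | gray t && (t \in canonical (int_content m))) 'X_[content t])%R.

Lemma canonical_set_poly (R : comNzRingType) m :
  (#|canonical_set j_gt0 m|%:R = (canonical_poly R m * gray_poly k R ^+ j.-1)@_m)%R.
Proof.
pose a0 := Ordinal j_gt0.
pose F (a : 'I_j) := [set t : gword | gray t && ((a == a0) ==> (t \in canonical (int_content m)))].
have -> : canonical_set j_gt0 m = [set W : {ffun 'I_j -> gword} |
    (W \in family F) && ((\sum_(a < j) content (W a))%MM == m)].
  apply/setP=> W; rewrite 2!inE [RHS]inE andbAC; congr (_ && _).
  apply/andP/forallP => [[/forallP gW cW] a|h].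
    by rewrite inE gW; apply/implyP=> /eqP ->.
  split; last by have := h a0; rewrite inE eqxx => /andP[].
  by apply/forallP=> a; have := h a; rewrite inE => /andP[].
rewrite card_family_poly; congr (_@_m)%R.
rewrite (bigD1 a0) //=; congr (_ * _)%R.
  by apply: eq_bigl => t; rewrite inE eqxx.
rewrite (eq_bigr (fun=> gray_poly k R)) => [|a /negPf aa0].
  rewrite prodr_const; congr (_ ^+ _)%R.
  by rewrite -[in RHS](card_ord j) -(cardC1 a0).
by apply: eq_bigl => t; rewrite inE aa0 andbT.
Qed.

Lemma mdeg_word_families m W : W \in word_families j m -> mdeg m = j * (2 ^ k).-1.
Proof.
rewrite inE => /andP[_ /eqP <-]; rewrite mdeg_sum /=.
under eq_bigr => a _ do rewrite mdeg_content size_tuple.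
by rewrite sum_nat_const card_ord.
Qed.

Lemma odd_F2 n : (n%:R != 0 :> 'F_2)%R = odd n.
Proof. by rewrite F2_natr_odd; case: odd. Qed.

Lemma odd_noniso m : odd (num_noniso j (int_content m)) = ((dickson [set: 'I_k] ^+ j)@_m != 0)%R.
Proof. by rewrite num_noniso_eq // -odd_F2 word_families_poly gray_poly_F2. Qed.

Lemma odd_nonequiv m : odd (num_nonequiv j (int_content m)) =
  ((canonical_poly 'F_2 m * dickson [set: 'I_k] ^+ j.-1)@_m != 0)%R.
Proof. by rewrite (num_nonequiv_eq j_gt0) -odd_F2 canonical_set_poly gray_poly_F2. Qed.

Lemma odd_nonequiv_noniso m : odd (num_noniso j (int_content m)) -> odd (num_nonequiv j (int_content m)).
Proof. by rewrite num_noniso_stabilizer // oddM => /andP[]. Qed.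

(** An odd number of classes implies that there is an equiparting matrix, which
makes [c] nonnegative with the prescribed sum. *)
Lemma odd_partition_int_content (R : rel 'M[bool]_(k, j * 2 ^ k)) c :
    odd #|equivalence_partition R (equiparting_set j c)| ->
  exists m, [/\ c = int_content m & (\sum_(i < k) c i)%R = Posz (j * (2 ^ k - 1))].
Proof.
have [->|/set0Pn[A]] := eqVneq (equiparting_set j c) set0.
  by rewrite /equivalence_partition imset0 cards0.
rewrite inE => /(equipartingP j_gt0)[W [e [gW cW _]]] _.
pose m := (\sum_(a < j) content (W a))%MM.
have Dc : c = int_content m.
  apply/ffunP=> i; rewrite ffunE cW mnm_sumE; congr Posz.
  by apply: eq_bigr => a _; rewrite contentE.
exists m; split=> //; rewrite subn1 -(@mdeg_word_families m W) ?inE ?gW //=.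
rewrite mdegE Dc (big_morph Posz PoszD erefl).
by apply: eq_bigr => i _; rewrite ffunE.
Qed.

Lemma calI_int_content c : calI j c -> exists m, c = int_content m.
Proof. by case=> _ /odd_partition_int_content[m [-> _]]; exists m. Qed.

Lemma calE_int_content c : calE j c -> exists m, c = int_content m.
Proof. by case=> _ /odd_partition_int_content[m [-> _]]; exists m. Qed.

Lemma calI_odd m : odd (num_noniso j (int_content m)) -> calI j (int_content m).
Proof. by move=> o; have [m' [_ sm]] := odd_partition_int_content o. Qed.

Lemma calE_odd m : odd (num_nonequiv j (int_content m)) -> calE j (int_content m).
Proof. by move=> o; have [m' [_ sm]] := odd_partition_int_content o. Qed.

End Counting.

Section Bounds.
Variable k : nat.
Hypothesis k_gt0 : 0 < k.
Implicit Types (m : 'X_{1..k}).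

Lemma setT_neq0 : [set: 'I_k] != set0.
Proof. by rewrite -card_gt0 cardsT card_ord. Qed.

Lemma noniso_lower n r m : odd (num_noniso (2 ^ n + r) (int_content m)) ->
  exists i, 2 ^ (n + k - 1) + r <= m i.
Proof.
rewrite odd_noniso; last by rewrite addn_gt0 expn_gt0.
rewrite exprD => /(dickson_lower setT_neq0 (r := r)) [i iS|i _].
  by have := @vanishes_exp _ _ i 1 r _ (dickson_vanishes iS); rewrite mul1n.
by rewrite cardsT card_ord -addnBA // subn1; exists i.
Qed.

(** For [r > 0] one of the [2 ^ n + r] words can be taken canonical and still leave
[2 ^ n] free words, whose generating polynomial is a [2 ^ n]-th power. *)
Lemma nonequiv_lower n r m : 0 < r -> odd (num_nonequiv (2 ^ n + r) (int_content m)) ->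
  exists i, 2 ^ (n + k - 1) + r <= m i.
Proof.
case: r => // r _; rewrite odd_nonequiv; last by rewrite addn_gt0 expn_gt0.
rewrite addnS /= exprD mulrCA => /(dickson_lower setT_neq0 (r := r.+1)) [i iS|i _].
  apply: (@vanishesM _ _ i 1 r); last first.
    by have := @vanishes_exp _ _ i 1 r _ (dickson_vanishes iS); rewrite mul1n.
  apply: vanishes_sum => t /andP[gt _] c ci; rewrite mcoeffX; case: eqP => // Dc.
  have := gray_mem i gt; rewrite -has_pred1 has_count -contentE Dc.
  by move: ci; case: (c i).
by rewrite cardsT card_ord -addnBA // subn1; exists i.
Qed.

Lemma noniso_witness n r : r < 2 ^ n -> exists m,
  odd (num_noniso (2 ^ n + r) (int_content m)) /\ forall i, m i <= 2 ^ (n + k - 1) + r.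
Proof.
move=> lt; have [m [_ mle mnz]] := dickson_witness [set: 'I_k] lt.
exists m; split; first by rewrite odd_noniso // addn_gt0 expn_gt0.
move=> i; have := mle i (in_setT i); rewrite cardsT card_ord.
have -> : 2 ^ (n + k) = 2 * 2 ^ (n + k - 1) by rewrite -expnS; congr (2 ^ _); lia.
by rewrite -mulnDr leq_pmul2l.
Qed.

Lemma nonequiv_witness n r : r < 2 ^ n -> exists m,
  odd (num_nonequiv (2 ^ n + r) (int_content m)) /\ forall i, m i <= 2 ^ (n + k - 1) + r.
Proof.
move=> /noniso_witness[m [om mle]]; exists m; split=> //.
by apply: odd_nonequiv_noniso om; rewrite addn_gt0 expn_gt0.
Qed.

Lemma stabilizer_pair m (A B : 'I_k) : A != B -> m A = m B ->
    (forall i i', m i = m i' -> i = i' \/ (i \in [:: A; B]) && (i' \in [:: A; B])) ->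
  #|[set s | stabilizes (int_content m) s]| = 2.
Proof.
move=> AB mAB mP; have -> : [set s | stabilizes (int_content m) s] = [set 1%g; tperm A B].
  apply/setP=> s; rewrite !inE; apply/idP/orP => [/forallP h|[]/eqP ->].
  - have sP i : s i = i \/ (s i \in [:: A; B]) && (i \in [:: A; B]).
      by apply: mP; have := h i; rewrite !ffunE => /eqP[].
    have fix_ i : i != A -> i != B -> s i = i.
      by move=> /negPf iA /negPf iB; case: (sP i) => //; rewrite !inE iA iB andbF.
    have [sA|sA] := eqVneq (s A) A.
      left; apply/eqP/permP=> i; rewrite perm1.
      have [->|iA] := eqVneq i A; first by [].
      have [->|iB] := eqVneq i B; last exact: fix_.
      case: (sP B) => //; rewrite !inE => /andP[/orP[]/eqP // sB _].
      by case/eqP: AB; apply: (@perm_inj _ s); rewrite sA sB.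
    right; apply/eqP/permP=> i.
    have sA' : s A = B.
      case: (sP A) => [e|]; first by rewrite e eqxx in sA.
      by rewrite !inE (negPf sA) => /andP[/eqP].
    have sB : s B = A.
      case: (sP B) => [e|]; first by case/eqP: AB; apply: (@perm_inj _ s); rewrite sA' e.
      rewrite !inE => /andP[/orP[]/eqP // sB _].
      by case/eqP: AB; apply: (@perm_inj _ s); rewrite sA' sB.
    by case: tpermP => [->|->|/eqP iA /eqP iB] //; apply: fix_.
  - exact: stabilizes1.
  - apply/forallP=> i; rewrite !ffunE.
    by case: tpermP => [->|->|//]; rewrite mAB.
rewrite cards2; case: eqP => // e.
by case/eqP: AB; rewrite -[B](tpermL A) -e perm1.
Qed.

Lemma odd_nonequiv_half j m : 0 < j -> num_noniso j (int_content m) = 2 %[mod 4] ->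
  #|[set s | stabilizes (int_content m) s]| = 2 -> odd (num_nonequiv j (int_content m)).
Proof.
move=> j0 n2 s2; move: n2; rewrite num_noniso_stabilizer // s2.
move: (num_nonequiv _ _) => x; lia.
Qed.

End Bounds.

(** * The minima *)

Section MuStabilizer.
Variable k : nat.
Implicit Types (s : nat).

Lemma mu_inj s (i i' : 'I_k) : 2 <= s -> i < s -> i' < s -> mu k s i = mu k s i' ->
  i = i' \/ ends s i && ends s i'.
Proof.
move=> s2 is_ i's; rewrite !mnmE is_ i's.
have odd_ne e : (2 ^ s.-1).+1 <> 2 ^ e.+1.
  move/(congr1 odd); rewrite /= !oddX /=.
  by case: s s2 {is_ i's} => [|[]].
case: ifP => _; case: ifP => _; [by right | by move/odd_ne | by move/esym/odd_ne |].
by move/eqP; rewrite eqn_exp2l // => /eqP[] /val_inj ->; left.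
Qed.

Lemma mu_le s (i : 'I_k) : mu k s i <= (2 ^ s.-1).+1.
Proof.
rewrite mnmE /ends; case: eqP => //= _; case: eqP => //= ne; case: ifP => // lt.
by apply: leqW; rewrite leq_exp2l //; lia.
Qed.

Lemma nonequiv_pow2_witness n : 2 <= k -> exists m : 'X_{1..k},
  odd (num_nonequiv (2 ^ n.+1) (int_content m)) /\
  forall i, m i <= 2 ^ (n + k - 1) + 2 ^ n.
Proof.
move=> k2; have k0 : 0 < k by lia.
have kB : k.-1 < k by lia.
pose A := Ordinal k0; pose B := Ordinal kB.
have AB : A != B by apply/eqP=> /(congr1 val) /=; lia.
have j0 : 0 < 2 ^ n.+1 by rewrite expn_gt0.
have k2k : 2 <= k <= k by rewrite k2 leqnn.
exists (mu k k *+ 2 ^ n)%MM; split; last first.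
  move=> i; rewrite mulmnE -addnBA // expnD subn1 addnC -mulnS mulnC leq_pmul2l ?expn_gt0 //.
  exact: mu_le.
apply: odd_nonequiv_half => //.
  apply: Z4_natr_inj; rewrite num_noniso_eq // word_families_poly.
  pose U := enum [set t : (2 ^ k).-1.-tuple 'I_k | gray t].
  have -> : gray_poly k 'Z_4 = (\sum_(t <- U) 'X_[content t])%R.
    by rewrite big_enum; apply: eq_bigl => t; rewrite inE.
  have cU c : count_mem c [seq content (val t) | t <- U] =
      if mdeg c == (2 ^ k).-1 then num_gray c else 0.
    rewrite -card_gray_tuples cardE count_map -size_filter /U.
    apply: perm_size; apply: uniq_perm => [||t]; [exact/filter_uniq/enum_uniq | exact: enum_uniq |].
    by rewrite mem_filter !mem_enum !inE andbC.
  apply: (count_sqr_mod4 (f := fun t => content (val t))) => // [c||].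
  - by rewrite mem_odd_part cU; case: ifP.
  - by rewrite mem_odd_part cU mdeg_up // eqxx odd_num_gray_up.
  - by rewrite mem_odd_part cU mdeg_swapped // eqxx odd_num_gray_swapped.
apply: (stabilizer_pair AB).
  by rewrite !mulmnE !mnmE /ends /= eqxx orbT.
move=> i i' /eqP; rewrite !mulmnE eqn_pmul2r ?expn_gt0 // => /eqP.
case/(mu_inj k2 (ltn_ord i) (ltn_ord i')); first by left.
by right; rewrite !inE.
Qed.

Lemma nonequiv_one_witness : 3 <= k -> exists m : 'X_{1..k},
  odd (num_nonequiv 1 (int_content m)) /\ forall i, m i <= 2 ^ (k - 2) + 1.
Proof.
move=> k3; pose s := k.-1.
have s2 : 2 <= s by rewrite /s; lia.
have sk : s < k by rewrite /s; lia.
have s2k : 2 <= s <= k by rewrite s2 ltnW.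
have k0 : 0 < k by lia.
have kB : s.-1 < k by lia.
pose A := Ordinal k0; pose B := Ordinal kB; pose L := Ordinal sk.
have AB : A != B by apply/eqP=> /(congr1 val) /=; lia.
have muL : mu k s L = 0.
  by rewrite mnmE /ends /= ltnn ifF //; apply/negbTE; rewrite negb_or; apply/andP; split; apply/eqP; lia.
have lamE (i : 'I_k) : i < s -> (mu k s + U_(L))%MM i = mu k s i.
  by move=> lt; rewrite mnmDE mnm1E -(inj_eq val_inj) /= gtn_eqF ?addn0.
have lamL : (mu k s + U_(L))%MM L = 1 by rewrite mnmDE mnm1E muL eqxx.
have iP (i : 'I_k) : i < s \/ i = L.
  have [|ge] := ltnP i s; [by left | right; apply/val_inj => /=].
  by have := ltn_ord i; lia.
have mu_gt1 (i : 'I_k) : i < s -> 1 < mu k s i.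
  move=> lt; rewrite mnmE lt; case: ifP => _; first by rewrite ltnS expn_gt0.
  by rewrite -{1}[1](expn0 2) ltn_exp2l.
exists (mu k s + U_(L))%MM; split; last first.
  move=> i; case: (iP i) => [lt|->]; last by rewrite lamL addn1.
  by rewrite lamE // addn1 (_ : k - 2 = s.-1) ?mu_le // /s; lia.
apply: odd_nonequiv_half => //.
  rewrite -(@num_gray_mu_add1 k s L) //; congr (_ %% 4).
  rewrite num_noniso_eq //.
  have := card_gray_tuples (mu k s + U_(L))%MM.
  have -> : mdeg (mu k s + U_(L)) = (2 ^ k).-1.
    rewrite -up_add_swapped // !mdegD mdeg1 mdeg_up ?mdeg_swapped // ?(ltnW sk) //.
    have -> : 2 ^ k = 2 * 2 ^ s by rewrite -expnS prednK.
    by have := expn_gt0 2 s; lia.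
  rewrite eqxx => <-.
  (* A family indexed by 'I_1 is a single word. *)
  pose g (t : (2 ^ k).-1.-tuple 'I_k) : {ffun 'I_1 -> _} := [ffun=> t].
  rewrite -(card_imset (f := g)); last by move=> t t' /ffunP/(_ ord0); rewrite !ffunE.
  congr #|pred_of_set _|; apply/setP=> W; rewrite inE big_ord1; apply/andP/imsetP.
    case=> /forallP gW cW; exists (W ord0); first by rewrite inE gW.
    by apply/ffunP=> a; rewrite ffunE ord1.
  case=> t; rewrite inE => /andP[gt ctt] ->; rewrite ffunE; split=> //.
  by apply/forallP=> a; rewrite ffunE.
apply: (stabilizer_pair AB).
  rewrite !lamE /=; [|lia|lia].
  by rewrite !mnmE /ends /= eqxx orbT.
move=> i i'; case: (iP i) => [lt|->]; case: (iP i') => [lt'|->]; last by left.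
- rewrite !lamE // => /(mu_inj s2 lt lt') [|e]; [by left | right].
  by rewrite !inE.
- by rewrite lamE // lamL => e; have := mu_gt1 i lt; rewrite e.
- by rewrite lamL lamE // => e; have := mu_gt1 i' lt'; rewrite -e.
Qed.

End MuStabilizer.

(** The minimum is [v] as soon as some member is bounded by [v] and every member
has an entry at least [v]. *)
Lemma is_min_max_intro k (S : {ffun 'I_k -> int} -> Prop) (v : nat) :
    (forall c, S c -> exists m, c = int_content m) ->
    (exists2 m, S (int_content m) & forall i, m i <= v) ->
    (forall m, S (int_content m) -> exists i, v <= m i) ->
  is_min_max S (Posz v).
Proof.
move=> Sint [m Sm mle] low; split.
  exists (int_content m); split=> //; split; last by move=> i; rewrite ffunE lez_nat.
  have [i vi] := low m Sm; exists i; rewrite ffunE; congr Posz.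
  by apply/eqP; rewrite eqn_leq mle.
move=> c w Sc [_ cw]; have [m' Dc] := Sint c Sc; rewrite Dc in Sc cw.
have [i vi] := low m' Sc; apply: le_trans (cw i).
by rewrite ffunE lez_nat.
Qed.

(** The tuples with an odd number of classes are exponent vectors of fixed degree,
so the minimum is taken over a finite set. *)
Lemma is_E_exists j k (m : 'X_{1..k}) (v : nat) : 0 < j -> 0 < k ->
    odd (num_nonequiv j (int_content m)) -> (forall i, m i <= v) ->
  exists2 w : nat, is_E j k (Posz w) & w <= v.
Proof.
move=> j0 k0 om mle; pose b := (j * (2 ^ k).-1).+1.
have bound (m' : 'X_{1..k}) : odd (num_nonequiv j (int_content m')) -> mdeg m' < b.
  move=> o; have := odd_partition_int_content j0 o => -[_ [_]].
  rewrite (eq_bigr (fun i => Posz (m' i))) => [|i _]; last by rewrite ffunE.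
  by rewrite -(big_morph Posz PoszD erefl) -mdegE subn1 => -[->].
pose P (x : 'X_{1..k < b}) := odd (num_nonequiv j (int_content (val x))).
pose mx (x : 'X_{1..k < b}) := \max_(i < k) (val x) i.
pose x0 : 'X_{1..k < b} := BMultinom (bound m om).
have Px0 : P x0 by [].
case: (arg_minnP mx Px0) => x Px xmin.
exists (mx x); last first.
  by apply: leq_trans (xmin _ Px0) _; apply/bigmax_leqP=> i _; apply: mle.
apply: is_min_max_intro; first by move=> c; apply: calE_int_content.
  exists (val x); first exact: calE_odd.
  by move=> i; rewrite /mx (bigD1 i) //= leq_maxl.
move=> m' [_ o]; have := xmin (BMultinom (bound m' o)) o.
have [|i Di] := @bigop.eq_bigmax 'I_k (fun i => m' i); first by rewrite card_ord.
by rewrite /mx /= Di; exists i.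
Qed.

Theorem theorem2p15 (k : nat) (hk : 2 <= k) :
  (forall n r : nat, r < 2 ^ n ->
     is_I (2 ^ n + r) k (Posz (2 ^ (n + k - 1) + r)))
  /\
  ((exists v : int, is_E 1 k v /\ (v <= Posz (2 ^ (k - 2) + 1))%R)
   /\
   (forall n r : nat, 1 <= r <= 2 ^ n ->
      is_E (2 ^ n + r) k (Posz (2 ^ (n + k - 1) + r)))).
Proof.
have k0 : 0 < k by lia.
have j0 n r : 0 < 2 ^ n + r by rewrite addn_gt0 expn_gt0.
split=> [n r lt_r|].
  apply: is_min_max_intro; first by move=> c; apply: calI_int_content.
    have [m [om mle]] := noniso_witness k0 lt_r.
    by exists m => //; apply: calI_odd.
  by move=> m [_]; apply: noniso_lower.
split=> [|n r /andP[r0 le_r]].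
  have [m [om mle]] : exists m : 'X_{1..k}, odd (num_nonequiv 1 (int_content m)) /\
      forall i, m i <= 2 ^ (k - 2) + 1.
    have [k2|k3] := leqP k 2; last exact: nonequiv_one_witness.
    have [m [om mle]] := @nonequiv_witness k k0 0 0 isT; exists m; split=> // i.
    by apply: leq_trans (mle i) _; have -> : k = 2 by lia.
  have [w Ew le_w] := is_E_exists (j := 1) isT k0 om mle.
  by exists (Posz w).
apply: is_min_max_intro; first by move=> c; apply: calE_int_content.
  have [m [om mle]] : exists m : 'X_{1..k}, odd (num_nonequiv (2 ^ n + r) (int_content m)) /\
      forall i, m i <= 2 ^ (n + k - 1) + r.
    move: le_r; rewrite leq_eqVlt => /orP[/eqP->|]; last exact: nonequiv_witness.
    by rewrite addnn -mul2n -expnS; apply: nonequiv_pow2_witness.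
  by exists m => //; apply: calE_odd.
by move=> m [_]; apply: nonequiv_lower.
Qed.
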